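(* Let $\mathbb{F}$ be a field of characteristic $0$, $0\neq h\in\mathbb{F}[x]$, and $A=A_h\subseteq A_1$ as in the context. Identify $\mathrm{HH}^2(A)$ with $\mathsf{D}[\hat y]$, $\mathsf{D}=\mathbb{F}[x]/\gcd(h,h')\mathbb{F}[x]$, as described in the context, and consider the Lie action of $\mathrm{HH}^1(A)$ on $\mathrm{HH}^2(A)$ given by the Gerstenhaber bracket. Then the center $\mathsf{Z}(\mathrm{HH}^1(A))$ of the Lie algebra $\mathrm{HH}^1(A)$ acts trivially: $[\mathsf{Z}(\mathrm{HH}^1(A)),\mathrm{HH}^2(A)]=0$; and for all $g,p\in\mathbb{F}[x]$ and $n,k\geq0$, $$[\mathrm{ad}_{ga_n},\,p\hat y^k]=\Big(n\pi_hg\,p'-ng\frac{\pi_hh'}{h}\,p-k\,\delta_0(g)\,p\Big)\hat y^{\,n+k-1}\quad\text{in }\mathsf{D}[\hat y]$$ (the right side being $0$ when $n=k=0$).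
   Context: $A_1$ is the Weyl algebra generated by $x,y$ with $yx-xy=1$, and $A=A_h$ is its unital subalgebra generated by $x$ and $\hat y=yh$ (so $\hat yx-x\hat y=h$). $\pi_h\in\mathbb{F}[x]$ is the monic polynomial equal, up to a nonzero scalar, to $h/\gcd(h,h')$; note $\pi_hh'/h=h'/\gcd(h,h')\in\mathbb{F}[x]$ up to scalar. Let $a_n=\pi_hh^{n-1}y^n\in A_1$ for $n\geq1$ and $a_0=\pi_h/h$ (in the localization of $A_1$ at powers of $h$); for $g\in\mathbb{F}[x]$ and $n\geq0$, $\mathrm{ad}_{ga_n}(u)=[ga_n,u]$ defines a derivation of $A$, and we use the same notation for its class in $\mathrm{HH}^1(A)$. $\delta_0(g)=(g\pi_h)'-g\pi_hh'/h$. Identification: let $V=\mathbb{F}x\oplus\mathbb{F}\hat y$, $R=\mathbb{F}r$, and consider the free $A$-bimodule resolution $0\to A\otimes R\otimes A\xrightarrow{d_1}A\otimes V\otimes A\xrightarrow{d_0}A\otimes A\xrightarrow{\mu}A\to0$ with $\mu$ multiplication, $d_0(1\otimes v\otimes1)=v\otimes1-1\otimes v$, $d_1(1\otimes r\otimes1)=1\otimes\hat y\otimes x+\hat y\otimes x\otimes1-1\otimes x\otimes\hat y-x\otimes\hat y\otimes1-s_0(h\otimes1)$, where $s_0$ is the right $A$-linear map with $s_0(x^k\hat y^\ell\otimes1)=\sum_{i=0}^{k-1}x^i\otimes x\otimes x^{k-1-i}\hat y^\ell+\sum_{j=0}^{\ell-1}x^k\hat y^j\otimes\hat y\otimes\hat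 y^{\ell-1-j}$. Computing Hochschild cohomology with this resolution, the class of the bimodule map $\chi_a$ with $\chi_a(1\otimes r\otimes1)=a$ gives an isomorphism $A/\gcd(h,h')A\cong\mathrm{HH}^2(A)$, and $A/\gcd(h,h')A\cong\mathsf{D}[\hat y]$ (polynomials in $\hat y$ with coefficients in $\mathsf{D}$). The Gerstenhaber bracket makes $\mathrm{HH}^\bullet(A)$ a Lie module over the Lie algebra $\mathrm{HH}^1(A)$ of outer derivations. *)

(* Defs.v *)
From HB Require Import structures.
From mathcomp Require Import all_boot all_order all_algebra.
From mathcomp Require Import fraction generic_quotient.
Set Implicit Arguments. Unset Strict Implicit. Unset Printing Implicit Defensive.
Import GRing.Theory.
Local Open Scope ring_scope.

(* Model.  The Weyl algebra A_1 = F<x,y>/(yx-xy-1) and its localization at the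
   powers of h are realized (faithfully, char F = 0) as algebras of
   F-linear operators on the rational function field FX = F(x):
   x acts by multiplication by x and y acts by d/dx.  The product of the
   algebra is composition of operators ((P * Q) u = P (Q u)). *)

Section Model.
Variable F : fieldType.

Definition FX := {fraction {poly F}}.
Definition op := FX -> FX.

Definition pF (p : {poly F}) : FX := tofrac p.

(* derivative on F(x), computed on any representative n/d:
   (n/d)' = (n' d - n d') / d^2  (independent of the representative) *)
Definition deriv_frac (r : FX) : FX :=
  let q := repr r in
  (pF ((frac q).1^`() * (frac q).2 - (frac q).1 * (frac q).2^`()))
    / pF ((frac q).2 ^+ 2).

Definition opmul (c : FX) : op := fun u => c * u.
Definition opadd (P Q : op) : op := fun u => P u + Q u.
Definition opsub (P Q : op) : op := fun u => P u - Q u.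
Definition opcomp (P Q : op) : op := fun u => P (Q u).
Definition opone : op := fun u => u.
Definition opzero : op := fun _ => 0.
Definition opscale (c : F) (P : op) : op := fun u => pF c%:P * P u.
Definition oppow (P : op) (n : nat) : op := iter n (opcomp P) opone.
Definition lie (P Q : op) : op := opsub (opcomp P Q) (opcomp Q P).

Definition opx : op := opmul (pF 'X).
Definition opy : op := deriv_frac.

Section Ah.
Variable h : {poly F}.

Definition opyhat : op := opcomp opy (opmul (pF h)).

Inductive inA : op -> Prop :=
  | inA_scal (c : F) : inA (opmul (pF c%:P))
  | inA_x : inA opx
  | inA_yhat : inA opyhat
  | inA_add P Q : inA P -> inA Q -> inA (opadd P Q)
  | inA_comp P Q : inA P -> inA Q -> inA (opcomp P Q).

Definition gcdh : {poly F} := gcdp h h^`().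
Definition pih : {poly F} :=
  (lead_coef (h %/ gcdh))^-1 *: (h %/ gcdh).

Definition ga (g : {poly F}) (n : nat) : op :=
  if n is n'.+1 then
    opcomp (opmul (pF (g * pih * h ^+ n'))) (oppow opy n)
  else opmul (pF g * pF pih / pF h).

Definition ad_ga (g : {poly F}) (n : nat) : op -> op := fun u => lie (ga g n) u.

Definition delta0 (g : {poly F}) : FX :=
  pF ((g * pih)^`()) - pF g * pF pih * pF h^`() / pF h.

Definition cochain1 (D : op -> op) : Prop :=
  (forall a, inA a -> inA (D a)) /\
  (forall a b, inA a -> inA b -> D (opadd a b) = opadd (D a) (D b)) /\
  (forall c a, inA a -> D (opscale c a) = opscale c (D a)).

Definition is_der (D : op -> op) : Prop :=
  cochain1 D /\
  forall a b, inA a -> inA b ->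
    D (opcomp a b) = opadd (opcomp (D a) b) (opcomp a (D b)).

Definition is_inner (D : op -> op) : Prop :=
  exists c, inA c /\ forall a, inA a -> D a = lie c a.

Definition der_bracket (D E : op -> op) : op -> op :=
  fun a => opsub (D (E a)) (E (D a)).

Definition cochain2 (f : op -> op -> op) : Prop :=
  (forall a b, inA a -> inA b -> inA (f a b)) /\
  (forall a a' b, inA a -> inA a' -> inA b ->
      f (opadd a a') b = opadd (f a b) (f a' b)) /\
  (forall a b b', inA a -> inA b -> inA b' ->
      f a (opadd b b') = opadd (f a b) (f a b')) /\
  (forall c a b, inA a -> inA b ->
      f (opscale c a) b = opscale c (f a b) /\ f a (opscale c b) = opscale c (f a b)).

Definition hoch1 (g : op -> op) : op -> op -> op :=
  fun a b => opadd (opsub (opcomp a (g b)) (g (opcomp a b))) (opcomp (g a) b).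

Definition cocycle2 (f : op -> op -> op) : Prop :=
  cochain2 f /\
  forall a b c, inA a -> inA b -> inA c ->
    opadd (opsub (opcomp a (f b c)) (f (opcomp a b) c))
          (opsub (f a (opcomp b c)) (opcomp (f a b) c)) = opzero.

Definition coboundary2 (f : op -> op -> op) : Prop :=
  exists g, cochain1 g /\ forall a b, inA a -> inA b -> f a b = hoch1 g a b.

Definition gbracket (D : op -> op) (f : op -> op -> op) : op -> op -> op :=
  fun a b => opsub (D (f a b)) (opadd (f (D a) b) (f a (D b))).

(* ---------- identification HH^2(A) = A / gcd(h,h') A ---------- *)
(* Pull-back of a bar 2-cochain f along the comparison map psi from the
   small resolution of the context to the bar resolution:
   psi_2(1(x)r(x)1) = 1(x)yhat(x)x(x)1 - 1(x)x(x)yhat(x)1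
      - sum_{k>=1} c_k sum_{i=1}^{k-1} 1(x)x^i(x)x(x)x^{k-1-i} + c_0 1(x)1(x)1(x)1,
   where h = sum_k c_k x^k.  The class of f corresponds to chi_{Phi f}. *)
Definition Phi (f : op -> op -> op) : op :=
  opadd (opsub (opsub (f opyhat opx) (f opx opyhat))
          (fun u => \sum_(1 <= k < size h) \sum_(1 <= i < k)
               pF (h`_k)%:P * opcomp (f (oppow opx i) opx) (oppow opx (k - 1 - i)) u))
        (opscale (h`_0) (f opone opone)).

Definition congA (P Q : op) : Prop :=
  exists b, inA b /\ P = opadd Q (opcomp (opmul (pF gcdh)) b).

End Ah.
End Model.

(* Main.v *)
(* In normal form, an element of A is a polynomial in F[x][yhat], and the
   product of A agrees with the commutative one modulo h.  A 2-cocycle f defines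
   a square-zero extension E of A by A; with X, Y the trivial lifts of x, yhat,
   Phi f is the defect Y X - X Y - h(X).  Since x, yhat and the relation
   yhat x - x yhat = h present A, f is a coboundary as soon as the lifts can be
   changed so that the defect vanishes, which is possible iff it lies in
   gcd(h,h') A.  Subtracting a coboundary, f may be assumed to vanish on
   F[x] x A and on A x {yhat}; then, modulo gcd(h,h') and with a = Phi f,
   f(yhat, Q) = a dQ/dx and f(Q, x) = a dQ/dyhat.  Hence, for a derivation D
   with D x = u = pi_h u1 and D yhat = v,
     Phi [D, f] = u da/dx + v da/dyhat - a (pi_h h'/h) u1  modulo gcd(h,h'),
   the last factor being the divergence of D.  The formula of the theorem is
   the case D = ad (g a_n).  If D is central, commuting with ad (g a_0) and
   ad (g a_1) for g = 1, x, x^2 modulo h forces u, v and the divergence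
   into gcd(h,h') A. *)

Require Import Defs.
From HB Require Import structures.
From mathcomp Require Import all_boot all_order all_algebra.
From mathcomp Require Import fraction generic_quotient separable.
From mathcomp Require Import ring.
From Stdlib Require Import FunctionalExtensionality ClassicalEpsilon.
Import GRing.Theory.
Local Open Scope ring_scope.
Set Implicit Arguments. Unset Strict Implicit. Unset Printing Implicit Defensive.

(** * Twisted evaluation of polynomials *)

Section CoefSum.
Variables (K : nzRingType) (V : zmodType) (g : nat -> K -> V).
Hypothesis g_add : forall i, {morph g i : a b / a + b}.

Definition csum (Q : {poly K}) : V := \sum_(i < size Q) g i Q`_i.

Let g0 i : g i 0 = 0.
Proof. by apply: (addrI (g i 0)); rewrite -g_add !addr0. Qed.

Lemma csum_wide n (Q : {poly K}) : (size Q <= n)%N ->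
  csum Q = \sum_(i < n) g i Q`_i.
Proof.
move=> le_Qn; rewrite /csum (big_ord_widen n (fun i => g i Q`_i)) //.
rewrite big_mkcond; apply: eq_bigr => i _; case: ltnP => // le_Qi.
by rewrite nth_default // g0.
Qed.

Lemma csumD : {morph csum : P Q / P + Q}.
Proof.
move=> P Q; pose n := maxn (size P) (size Q).
rewrite (@csum_wide n (P + Q)) ?size_polyD // (@csum_wide n P) ?leq_maxl //.
rewrite (@csum_wide n Q) ?leq_maxr // -big_split /=.
by apply: eq_bigr => i _; rewrite coefD g_add.
Qed.

Lemma csum0 : csum 0 = 0.
Proof. by rewrite /csum size_poly0 big_ord0. Qed.

Lemma csum_mono c i : csum (c%:P * 'X^i) = g i c.
Proof.
rewrite (@csum_wide i.+1); last first.
  by rewrite mul_polyC (leq_trans (size_scale_leq _ _)) ?size_polyXn.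
rewrite big_ord_recr /= coefCM coefXn eqxx mulr1 big1 ?add0r // => j _.
by rewrite coefCM coefXn ltn_eqF ?mulr0 ?g0.
Qed.

End CoefSum.

Section Eval.
Variables (K R : comNzRingType) (m : {rmorphism K -> R}) (T : R -> R).

(** Coefficients stand to the left of the iterates of [T] and need not commute with [T]. Taking [T]
    to be [lmulY] gives the product of A, and taking it to be the operator yhat gives the
    representation on F(x). *)
Definition ev (Q : {poly K}) (u : R) : R :=
  csum (fun i c => m c * iter i T u) Q.

Let g_add u i : {morph (fun c => m c * iter i T u) : a b / a + b}.
Proof. by move=> a b; rewrite rmorphD mulrDl. Qed.

Lemma ev_wide n (Q : {poly K}) u : (size Q <= n)%N ->
  ev Q u = \sum_(i < n) m Q`_i * iter i T u.
Proof. exact: csum_wide. Qed.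

Lemma evD P Q u : ev (P + Q) u = ev P u + ev Q u.
Proof. exact: csumD. Qed.

Lemma ev0 u : ev 0 u = 0.
Proof. exact: csum0. Qed.

Lemma evCM p Q u : ev (p%:P * Q) u = m p * ev Q u.
Proof.
rewrite (@ev_wide (size Q) (p%:P * Q)); last first.
  by rewrite mul_polyC size_scale_leq.
rewrite (@ev_wide (size Q)) // big_distrr; apply: eq_bigr => i _.
by rewrite coefCM rmorphM -mulrA.
Qed.

Lemma evC p u : ev p%:P u = m p * u.
Proof. by rewrite (@ev_wide 1) ?size_polyC_leq1 // big_ord1 coefC. Qed.

Lemma evMX Q u : ev (Q * 'X) u = ev Q (T u).
Proof.
rewrite (@ev_wide (size Q).+1) ?size_polyMX_leq //; last first.
  have [->|nzQ] := eqVneq Q 0; first by rewrite mul0r size_poly0.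
  by rewrite size_mulX.
rewrite big_ord_recl coefMX /= rmorph0 mul0r add0r.
rewrite (@ev_wide (size Q)) //; apply: eq_bigr => i _.
by rewrite coefMX /= -iterS iterSr.
Qed.

Lemma evX u : ev 'X u = T u.
Proof. by rewrite -['X]mul1r evMX -[1]/(1%:P) evC rmorph1 mul1r. Qed.

Hypothesis T_add : {morph T : u v / u + v}.

Let T0 : T 0 = 0.
Proof. by apply: (addrI (T 0)); rewrite -T_add !addr0. Qed.

Lemma evDr Q : {morph ev Q : u v / u + v}.
Proof.
move=> u v; rewrite !(@ev_wide (size Q)) // -big_split; apply: eq_bigr => i _ /=.
by rewrite -mulrDr; congr (_ * _); elim: (val i) => //= j ->; rewrite T_add.
Qed.

Variable e : {additive K -> K}.
Hypothesis T_lin : forall p u, T (m p * u) = m p * T u + m (e p) * u.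

Lemma ev_shift Q u : T (ev Q u) = ev (Q * 'X + map_poly e Q) u.
Proof.
rewrite evD evMX (@ev_wide (size Q) (map_poly e Q)) ?size_poly //.
rewrite !(@ev_wide (size Q)) // (big_morph T T_add T0) -big_split; apply: eq_bigr => i _ /=.
by rewrite T_lin coef_map -iterS iterSr.
Qed.

End Eval.

(** * The algebra A in normal form *)

Section Weyl.
Variable F : fieldType.
Variable h : {poly F}.
Local Notation PP := {poly {poly F}}.
Implicit Types (p q : {poly F}) (P Q R : PP).

Definition hder : {poly F} -> {poly F} := fun p => h * p^`().
Lemma hder_additive : zmod_morphism hder.
Proof. by move=> p q; rewrite /hder derivB mulrBr. Qed.
HB.instance Definition _ := GRing.isZmodMorphism.Build _ _ hder hder_additive.

Definition dx (Q : PP) : PP := map_poly (@deriv F) Q.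

Lemma dxD : {morph dx : P Q / P + Q}.
Proof. by move=> P Q; rewrite /dx raddfD. Qed.
Lemma dxB : {morph dx : P Q / P - Q}.
Proof. by move=> P Q; rewrite /dx raddfB. Qed.
Lemma dxN : {morph dx : P / - P}.
Proof. by move=> P; rewrite /dx raddfN. Qed.
Lemma dx0 : dx 0 = 0.
Proof. by rewrite /dx raddf0. Qed.
Lemma dxC p : dx p%:P = (p^`())%:P.
Proof. by rewrite /dx map_polyC. Qed.
Lemma dxM P Q : dx (P * Q) = dx P * Q + P * dx Q.
Proof.
apply/polyP => i; rewrite coefD coef_map !coefM /= raddf_sum -big_split /=.
by apply: eq_bigr => j _; rewrite !coef_map derivM.
Qed.
Lemma dxXn n : dx 'X^n = 0.
Proof.
apply/polyP => i; rewrite coef_map coefXn coef0 /=.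
by case: eqP => _; rewrite ?deriv0 // -[1]/(1%:P) derivC.
Qed.
Lemma dxX : dx 'X = 0.
Proof. by rewrite -['X]expr1 dxXn. Qed.

(* An element [\sum_j p_j(x) yhat^j] of A is encoded by the polynomial Q in
   F[x][Y] with the same coefficients; 'X is then yhat and ('X)%:P is x.
   [lmulY] is left multiplication by yhat, from [yhat p = p yhat + h p']. *)
Definition lmulY (Q : PP) : PP := Q * 'X + h%:P * dx Q.
Local Notation L := lmulY.

Lemma LE Q : L Q = Q * 'X + map_poly hder Q.
Proof. by congr (_ + _); apply/polyP => i; rewrite coefCM !coef_map. Qed.

Lemma LD : {morph L : P Q / P + Q}.
Proof. by move=> P Q; rewrite /lmulY dxD; ring. Qed.

Lemma LCM p Q : L (p%:P * Q) = p%:P * L Q + (hder p)%:P * Q.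
Proof. by rewrite /lmulY dxM dxC /hder polyCM; ring. Qed.

Definition star (P Q : PP) : PP := ev polyC L P Q.

(** Any [T] obeying the commutation rule of yhat makes its target a module over A. Associativity of
    [star] is the case [T] = [lmulY]; multiplicativity of [phi] is the case of the operator yhat. *)
Lemma ev_star (R : comNzRingType) (m : {rmorphism {poly F} -> R}) (T : R -> R) :
  {morph T : u v / u + v} ->
  (forall p u, T (m p * u) = m p * T u + m (hder p) * u) ->
  forall P Q u, ev m T (star P Q) u = ev m T P (ev m T Q u).
Proof.
move=> T_add T_lin P; elim/poly_ind: P => [|P p IHP] Q u.
  by rewrite /star !ev0.
by rewrite /star !evD !evMX !evC evCM -/(star _ _) IHP LE -ev_shift.
Qed.

Lemma starDl P1 P2 Q : star (P1 + P2) Q = star P1 Q + star P2 Q.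
Proof. exact: evD. Qed.
Lemma star0l Q : star 0 Q = 0.
Proof. exact: ev0. Qed.
Lemma starDr P Q1 Q2 : star P (Q1 + Q2) = star P Q1 + star P Q2.
Proof. exact: (evDr _ LD). Qed.
Lemma starC p Q : star p%:P Q = p%:P * Q.
Proof. exact: evC. Qed.
Lemma starCM p P Q : star (p%:P * P) Q = p%:P * star P Q.
Proof. exact: evCM. Qed.
Lemma star1l Q : star 1 Q = Q.
Proof. by rewrite -[1]/(1%:P) starC mul1r. Qed.
Lemma starMX P Q : star (P * 'X) Q = star P (L Q).
Proof. exact: evMX. Qed.
Lemma starX Q : star 'X Q = L Q.
Proof. exact: evX. Qed.
Lemma starA P Q R : star (star P Q) R = star P (star Q R).
Proof. by apply: ev_star => [|p u]; [exact: LD | exact: LCM]. Qed.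
Lemma starLr P Q : star (L P) Q = L (star P Q).
Proof. by rewrite -!starX starA. Qed.
Lemma starNl P Q : star (- P) Q = - star P Q.
Proof. by rewrite -mulN1r -polyCN starCM polyCN mulN1r. Qed.
Lemma starBl P1 P2 Q : star (P1 - P2) Q = star P1 Q - star P2 Q.
Proof. by rewrite starDl starNl. Qed.
Lemma starr0 P : star P 0 = 0.
Proof. by apply: (addrI (star P 0)); rewrite -starDr !addr0. Qed.
Lemma starNr P Q : star P (- Q) = - star P Q.
Proof. by apply: (addrI (star P Q)); rewrite -starDr !subrr starr0. Qed.
Lemma starBr P Q1 Q2 : star P (Q1 - Q2) = star P Q1 - star P Q2.
Proof. by rewrite starDr starNr. Qed.
Lemma iterL_Xn n k : iter n L 'X^k = 'X^(n + k).
Proof. by elim: n => //= n ->; rewrite /lmulY dxXn mulr0 addr0 -exprSr. Qed.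
Lemma star_mulX P n : star P 'X^n = P * 'X^n.
Proof.
transitivity ((\poly_(i < size P) P`_i) * 'X^n); last by rewrite coefK.
rewrite /star /ev /csum poly_def big_distrl /=; apply: eq_bigr => i _.
by rewrite iterL_Xn exprD -mul_polyC mulrA.
Qed.
Lemma star_rX P : star P 'X = P * 'X.
Proof. exact: (star_mulX P 1). Qed.
Lemma starr1 P : star P 1 = P.
Proof. by rewrite -[1](expr0 'X) star_mulX expr0 mulr1. Qed.

Lemma star_cr (a : F) P Q : star P (a%:P%:P * Q) = a%:P%:P * star P Q.
Proof.
rewrite -starC -starA; suff -> : star P a%:P%:P = a%:P%:P * P by rewrite starCM.
elim/poly_ind: P => [|P p IHP]; first by rewrite star0l mulr0.
rewrite starDl starC starMX.
have -> : L a%:P%:P = a%:P%:P * 'X by rewrite /lmulY dxC derivC mulr0 addr0.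
by rewrite -[_ * 'X]starC -starA IHP star_rX; ring.
Qed.

End Weyl.

(** * Divisibility of normal forms by polynomials in x *)

Section Ideal.
Variable F : fieldType.
Local Notation PP := {poly {poly F}}.
Implicit Types (d p q : {poly F}) (P Q R : PP).

(** This is the right ideal d A: left multiplication by an element of F[x] is the commutative
    product, by [starC]. *)
Definition Idl d Q := exists B, Q = d%:P * B.

Lemma Idl0 d : Idl d 0.
Proof. by exists 0; rewrite mulr0. Qed.
Lemma IdlD d P Q : Idl d P -> Idl d Q -> Idl d (P + Q).
Proof. by move=> [B ->] [B' ->]; exists (B + B'); rewrite mulrDr. Qed.
Lemma IdlN d P : Idl d P -> Idl d (- P).
Proof. by move=> [B ->]; exists (- B); rewrite mulrN. Qed.
Lemma IdlB d P Q : Idl d P -> Idl d Q -> Idl d (P - Q).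
Proof. by move=> dP dQ; apply/IdlD/IdlN. Qed.
Lemma IdlMl d P Q : Idl d Q -> Idl d (P * Q).
Proof. by move=> [B ->]; exists (P * B); rewrite mulrCA. Qed.
Lemma IdlMr d P Q : Idl d P -> Idl d (P * Q).
Proof. by rewrite mulrC; apply: IdlMl. Qed.
Lemma IdlC d Q : Idl d (d%:P * Q).
Proof. by exists Q. Qed.
Lemma Idl_sum d (I : Type) (r : seq I) (A : pred I) (G : I -> PP) :
  (forall i, A i -> Idl d (G i)) -> Idl d (\sum_(i <- r | A i) G i).
Proof. by move=> dG; apply: big_ind => //; [exact: Idl0 | exact: IdlD]. Qed.
Lemma Idl_trans d p Q : Idl (d * p) Q -> Idl d Q.
Proof. by move=> [B ->]; exists (p%:P * B); rewrite polyCM mulrA. Qed.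
Lemma IdlM2 d d' P Q : Idl d P -> Idl d' Q -> Idl (d * d') (P * Q).
Proof. by move=> [B ->] [B' ->]; exists (B * B'); rewrite polyCM; ring. Qed.
Lemma Idl_cancel d p Q : d != 0 -> Idl (d * p) (d%:P * Q) -> Idl p Q.
Proof.
move=> nzd [B]; rewrite polyCM -mulrA => /mulfI; rewrite polyC_eq0 => /(_ nzd) ->.
exact: IdlC.
Qed.
Lemma Idl_gauss d p q Q : coprimep p q -> Idl d (p%:P * Q) -> Idl d (q%:P * Q) -> Idl d Q.
Proof.
move/Bezout_eq1_coprimepP => [[s t] /= st1] dp dq.
rewrite -[Q]mul1r -[1]/(1%:P) -st1 polyCD !polyCM mulrDl -!mulrA.
by apply: IdlD; apply: IdlMl.
Qed.

Lemma Idl_deriv d Q : Idl d Q -> Idl d Q^`().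
Proof. by move=> [B ->]; exists B^`(); rewrite derivM derivC mul0r add0r. Qed.

Lemma PP_ind (K : PP -> Prop) : (forall P Q, K P -> K Q -> K (P + Q)) ->
  (forall c i j, K (c%:P%:P * (('X^i)%:P * 'X^j))) -> forall Q, K Q.
Proof.
move=> KD KX Q; have K0 : K 0 by have := KX 0 0%N 0%N; rewrite polyC0 mul0r.
rewrite -[Q]coefK poly_def; apply: (big_ind K) => // j _.
rewrite -mul_polyC -[Q`_j]coefK poly_def rmorph_sum big_distrl /=.
apply: (big_ind K) => // i _; rewrite -mul_polyC polyCM -mulrA; exact: KX.
Qed.

End Ideal.

(** * The factorization of h by gcd(h, h') and pi_h *)

Section Gcd.
Variables (F : fieldType) (h : {poly F}) (hnz : h != 0).
Local Notation gam := (gcdh h).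
Local Notation pi := (pih h).

Definition lcc : {poly F} := (lead_coef (h %/ gcdh h))%:P.
(* pi_h h' / h *)
Definition wh : {poly F} := (lead_coef (h %/ gcdh h))^-1 *: (h^`() %/ gcdh h).

Lemma gam_neq0 : gam != 0.
Proof. by rewrite /gcdh gcdp_eq0 negb_and hnz. Qed.
Lemma lc_neq0 : lead_coef (h %/ gcdh h) != 0.
Proof.
by rewrite lead_coef_eq0 dvdp_div_eq0 ?hnz // dvdp_gcdl.
Qed.
Lemma lcc_neq0 : lcc != 0.
Proof. by rewrite polyC_eq0 lc_neq0. Qed.

Lemma hE : h = lcc * pi * gam.
Proof.
rewrite /lcc /pih -mul_polyC mulrA -polyCM divff ?lc_neq0 // mul1r.
by rewrite divpK // dvdp_gcdl.
Qed.
Lemma dhE : h^`() = lcc * gam * wh.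
Proof.
rewrite /lcc /wh -mul_polyC mulrAC mulrA -polyCM divff ?lc_neq0 // mul1r.
by rewrite divpK // dvdp_gcdr.
Qed.
Lemma pi_neq0 : pi != 0.
Proof. by apply: contraNneq hnz => pi0; rewrite hE pi0 mulr0 mul0r. Qed.

(** Differentiate [hE] and compare with [dhE]. Consequently the vector field pi d/dx preserves
    multiples of [gam], although d/dx alone does not. *)
Lemma dgamE : gam^`() * pi = gam * (wh - pi^`()).
Proof.
have: h^`() = lcc * (pi^`() * gam + pi * gam^`()).
  by rewrite {1}hE -mulrA /lcc !derivM derivC mul0r add0r.
rewrite dhE -mulrA => /(mulfI lcc_neq0) e.
by rewrite mulrBr e; ring.
Qed.

Lemma coprime_pi_dpi : coprimep pi pi^`().
Proof.
have := make_separable hnz; rewrite unlock /= /pih derivZ.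
by rewrite coprimepZl ?coprimepZr // invr_neq0 ?lc_neq0.
Qed.

Lemma coprime_pi_wh : coprimep pi wh.
Proof.
rewrite /pih /wh coprimepZl ?coprimepZr ?invr_neq0 ?lc_neq0 //.
by rewrite coprimep_div_gcd // hnz.
Qed.

Lemma gam_bezout : exists s t, gam = s * h + t * h^`().
Proof.
have [[s t] /= e] := Bezoutp h h^`().
have /eqpf_eq [c nzc ->] : gam %= s * h + t * h^`() by rewrite eqp_sym.
by exists (c *: s), (c *: t); rewrite -!scalerAl -scalerDr.
Qed.

End Gcd.

(** * Commutators with x and the variation of h(x) *)

Section Commutators.
Variables (F : fieldType) (charF0 : [pchar F] =i pred0).
Variables (h : {poly F}) (hnz : h != 0).
Local Notation PP := {poly {poly F}}.
Local Notation gam := (gcdh h).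
Local Notation pi := (pih h).
Local Notation w := (wh h).
Local Notation L := (lmulY h).
Local Notation star := (star h).
Local Notation H := (h%:P : PP).
Local Notation dH := (h^`()%:P : PP).
Local Notation x := ('X%:P : PP).
Local Notation h2 := (h^`N(2)).
Implicit Types (p q : {poly F}) (P Q R U V : PP).

Lemma Idl_h_gam Q : Idl h Q -> Idl gam Q.
Proof. by move=> hQ; apply: (@Idl_trans _ _ (lcc h * pi)); rewrite mulrC -hE. Qed.

Lemma Idl_dh_gam Q : Idl h^`() Q -> Idl gam Q.
Proof.
by move=> hQ; apply: (@Idl_trans _ _ (lcc h * w)); rewrite mulrCA mulrA -dhE.
Qed.

Lemma Idl_hC Q : Idl gam (H * Q).
Proof. exact/Idl_h_gam/IdlC. Qed.
Lemma Idl_dhC Q : Idl gam (dH * Q).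
Proof. exact/Idl_dh_gam/IdlC. Qed.

(** The only departure from the commutative product is the term h dx Q in [lmulY]. *)
Lemma star_comm P Q : Idl h (star P Q - P * Q).
Proof.
elim/poly_ind: P Q => [|P p IHP] Q.
  by rewrite star0l mul0r subrr; apply: Idl0.
rewrite starDl starMX starC.
have -> : star P (L Q) + p%:P * Q - (P * 'X + p%:P) * Q =
  (star P (L Q) - P * L Q) + H * (P * dx Q) by rewrite /L; ring.
by apply: IdlD => //; apply: IdlC.
Qed.

Lemma star_comm_gam P Q : Idl gam (star P Q - P * Q).
Proof. exact/Idl_h_gam/star_comm. Qed.

(* The commutator with x is divisible by h: [[Q, x] = h * kap Q], see [star_x];
   [kapX j] is the value at yhat^j. *)
Fixpoint kapX j : PP :=
  if j is i.+1 then 'X^i + L (kapX i) + dH * kapX i else 0.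

Definition kap Q : PP := csum (fun i p => (p%:P : PP) * kapX i) Q.

Let kap_add i : {morph (fun p => p%:P * kapX i : PP) : p q / p + q}.
Proof. by move=> p q; rewrite polyCD mulrDl. Qed.

Lemma kapD : {morph kap : P Q / P + Q}.
Proof. exact: csumD. Qed.

Lemma kap_mono p i : kap (p%:P * 'X^i) = p%:P * kapX i.
Proof. exact: csum_mono. Qed.

Lemma star_x Q : star Q x = x * Q + H * kap Q.
Proof.
have starX_x j : star 'X^j x = x * 'X^j + H * kapX j.
  elim: j => [|j IHj]; first by rewrite expr0 star1l /=; ring.
  rewrite exprS -(star_mulX h) starA IHj starX LD !LCM /= /hder derivX mulr1.
  by rewrite /lmulY dxXn star_mulX; ring.
rewrite -[Q]coefK poly_def; elim/big_rec: _ => [|i P _ IHP].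
  by rewrite star0l mulr0 /kap csum0 mulr0 addr0.
by rewrite starDl kapD IHP -mul_polyC starCM starX_x kap_mono; ring.
Qed.

Lemma kap0 : kap 0 = 0.
Proof. exact: csum0. Qed.

Lemma kapCM p Q : kap (p%:P * Q) = p%:P * kap Q.
Proof.
rewrite -[Q]coefK poly_def; elim/big_rec: _ => [|i P _ IHP].
  by rewrite mulr0 kap0 mulr0.
by rewrite mulrDr !kapD IHP -mul_polyC mulrA -polyCM !kap_mono polyCM; ring.
Qed.

(** The corrections in the recursion of [kapX] carry a factor h or h', both multiples of [gam]; what
    remains is the Leibniz rule for the powers of yhat. *)
Lemma kap_deriv Q : Idl gam (kap Q - Q^`()).
Proof.
have kX j : Idl gam (kapX j - 'X^j^`()).
  elim: j => [|j IHj]; first by rewrite expr0 -[1]/(1%:P) derivC subr0; apply: Idl0.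
  rewrite exprSr derivM derivX mulr1 /=.
  have -> : 'X^j + L (kapX j) + dH * kapX j - (('X^j)^`() * 'X + 'X^j) =
    (kapX j - 'X^j^`()) * 'X + H * dx (kapX j) + dH * kapX j by rewrite /lmulY; ring.
  by do 2?apply: IdlD; [apply: IdlMr | apply: Idl_hC | apply: Idl_dhC].
rewrite -[Q]coefK poly_def; elim/big_rec: _ => [|i P _ IHP].
  by rewrite kap0 deriv0 subr0; apply: Idl0.
rewrite kapD derivD -mul_polyC kap_mono derivM derivC mul0r add0r.
have -> : (Q`_i)%:P * kapX i + kap P - ((Q`_i)%:P * ('X^i)^`() + P^`()) =
  (Q`_i)%:P * (kapX i - ('X^i)^`()) + (kap P - P^`()) by ring.
by apply: IdlD => //; apply: IdlMl.
Qed.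

(** [kapX j] has degree j - 1 in yhat with leading coefficient j, which is invertible in
    characteristic 0. Surjectivity of [kap] and faithfulness of [phi] both rest on this. *)
Lemma kapX_coef j m : (j <= m.+1)%N ->
  (kapX j)`_m = if j == m.+1 then j%:R else 0.
Proof.
elim: j m => [|j IHj] m; first by rewrite coef0.
rewrite ltnS => le_jm; rewrite /= !coefD coefXn !coefCM coefMX /dx coef_map /=.
have -> : (kapX j)`_m = 0 by rewrite IHj ?leqW // ltn_eqF.
rewrite deriv0 !mulr0 !addr0 eqSS eq_sym.
case: m le_jm => [|m] le_jm /=.
  by move: le_jm; rewrite leqn0 => /eqP ->; rewrite addr0.
by rewrite IHj //; case: eqP => _; rewrite ?addr0 // -natr1 addrC.
Qed.

Lemma kap_coef Q m : (size Q <= m.+2)%N -> (kap Q)`_m = m.+1%:R * Q`_m.+1.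
Proof.
move=> sQ; rewrite /kap (csum_wide kap_add sQ) coef_sum big_ord_recr.
rewrite coefCM (kapX_coef (leqnn m.+1)) eqxx mulrC big1 /= ?add0r // => i _.
by rewrite coefCM kapX_coef 1?ltnW ?ltn_ord // ltn_eqF // mulr0.
Qed.

Lemma size_kap Q n : (size Q <= n.+1)%N -> (size (kap Q) <= n)%N.
Proof.
move=> sQ; apply/leq_sizeP => m le_nm; rewrite kap_coef.
  by rewrite nth_default ?mulr0 // (leq_trans sQ).
by rewrite (leq_trans sQ) // !ltnS ltnW.
Qed.

Lemma natr_unit_poly n : exists c : {poly F}, c * n.+1%:R = 1.
Proof.
exists (n.+1%:R^-1)%:P; rewrite -polyC_natr -polyCM mulVf //.
by rewrite ((pcharf0P F).1 charF0).
Qed.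

(** Since [kap] lowers the degree in yhat by one, a preimage of the leading term is found by
    dividing by n + 1; the rest follows by induction on the degree. *)
Lemma kap_surj Q : exists V, kap V = Q.
Proof.
elim: (size Q) {-2}Q (leqnn (size Q)) => {Q} [|n IHn] Q sQ.
  by exists 0; rewrite kap0; apply/esym/eqP; rewrite -size_poly_leq0.
have [c cn] := natr_unit_poly n.
pose V0 : PP := (c * Q`_n)%:P * 'X^(n.+1).
have sV0 : (size V0 <= n.+2)%N.
  by rewrite /V0 mul_polyC (leq_trans (size_scale_leq _ _)) ?size_polyXn.
have /IHn [V eV] : (size (Q - kap V0)%R <= n)%N.
  apply/leq_sizeP => m; rewrite leq_eqVlt => /predU1P [<-|lt_nm].
    rewrite coefB kap_coef // /V0 coefCM coefXn eqxx mulr1 mulrA.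
    by rewrite [_ * c]mulrC cn mul1r subrr.
  by rewrite coefB !nth_default ?subr0 // (leq_trans _ lt_nm) ?size_kap.
by exists (V + V0); rewrite kapD eV subrK.
Qed.

(** Moving p(x) to the left past U costs a factor h at each order; the terms of order two and more
    are collected in [B]. *)
Lemma star_xn p U : exists B, star U p%:P =
  p%:P * U + H * (p^`()%:P * kap U) + H * H * B.
Proof.
elim/poly_ind: p U => [|p c IHp] U.
  exists 0; rewrite polyC0 starr0 deriv0; ring.
have [B eB] := IHp U; have [B' eB'] := IHp (kap U).
exists (x * B + p^`()%:P * kap (kap U) + H * B').
have -> : (p * 'X + c%:P)%:P = star x p%:P + c%:P%:P * 1.
  by rewrite starC mulr1 polyCD polyCM mulrC.
rewrite starDr star_cr starr1 -starA star_x starDl !starCM eB eB'.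
rewrite starC derivD derivM derivX derivC mulr1 addr0 !polyCD !polyCM; ring.
Qed.

Definition ddX k U : PP := \sum_(i < k) ('X^i)%:P * star U ('X^(k - 1 - i))%:P.

(* The first-order variation of h(x) when x varies by U. *)
Definition dpart U : PP := \sum_(1 <= k < size h) (h`_k)%:P%:P * ddX k U.

Lemma ddXS k U : ddX k.+1 U = star U ('X^k)%:P + x * ddX k U.
Proof.
rewrite /ddX big_ord_recl expr0 mul1r subn1 subn0; congr (_ + _).
rewrite big_distrr; apply: eq_bigr => i _; rewrite lift0 exprS polyCM -mulrA.
by rewrite /= ?subn1 -predn_sub subnS.
Qed.

(** Moving x^(k-1-i) past U costs (k-1-i) h x^(k-2) [kap U] to first order. Summing over i gives the
    binomial coefficient of k over 2, hence the divided second derivative. *)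
Lemma ddX_mod k U : exists B, ddX k U =
  ('X^k)^`()%:P * U + H * (('X^k)^`N(2)%:P * kap U) + H * H * B.
Proof.
elim: k => [|k [B IHk]].
  exists 0; rewrite /ddX big_ord0 expr0 -[1]/(1%:P) derivC nderivnC /= polyC0; ring.
have [B' eB'] := star_xn 'X^k U; exists (B' + x * B).
rewrite ddXS IHk eB' exprSr derivM derivX mulr1.
have -> : ('X^k * 'X)^`N(2) = ('X^k)^`() + ('X^k)^`N(2) * 'X :> {poly F}.
  by rewrite -[_ * 'X]addr0 -[0]/(0%:P) nderivnMXaddC nderivn1.
by rewrite !polyCD !polyCM; ring.
Qed.

Lemma linear_h (G : {linear {poly F} -> {poly F}}) : G 1 = 0 ->
  G h = \sum_(1 <= k < size h) (h`_k)%:P * G 'X^k.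
Proof.
move=> G1; rewrite -{1}[h]coefK poly_def raddf_sum.
rewrite -(big_mkord xpredT (fun k => G (h`_k *: 'X^k))).
rewrite big_ltn ?lt0n ?size_poly_eq0 // linearZ expr0 /= G1 scaler0 add0r.
by apply: eq_bigr => k _; rewrite linearZ mul_polyC.
Qed.

Local Notation dd := dpart.

(** The expansion is kept up to h^2 because the relation satisfied by a derivation is later divided
    by h and then read modulo h. *)
Lemma dd_mod U : exists B, dd U = dH * U + H * (h2%:P * kap U) + H * H * B.
Proof.
suff [B eB] : exists B, dd U =
    \sum_(1 <= k < size h) (h`_k)%:P%:P * (('X^k)^`()%:P * U + H * (('X^k)^`N(2)%:P * kap U))
    + H * H * B.
  exists B; rewrite eB; congr (_ + _).
  rewrite (linear_h (G := @deriv F)) ?(linear_h (G := nderivn 2)); first last.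
  - exact: (derivC 1).
  - exact: (nderivnC 1 2).
  rewrite !rmorph_sum /= !big_distrl big_distrr /= -big_split; apply: eq_bigr => k _ /=.
  by rewrite !polyCM; ring.
rewrite /dpart; elim/big_rec2: _ => [|k P R _ [B ->]]; first by exists 0; ring.
by have [B' ->] := ddX_mod k U; exists (B + (h`_k)%:P%:P * B'); ring.
Qed.

End Commutators.

(** * Hochschild cochains *)

Section Linear.
Variable F : fieldType.
Local Notation PP := {poly {poly F}}.
Implicit Types (D g : PP -> PP) (P Q : PP) (G : nat -> nat -> PP).

Definition linF g := (forall P Q, g (P + Q) = g P + g Q) /\
  (forall (a : F) Q, g (a%:P%:P * Q) = a%:P%:P * g Q).

Section LinTheory.
Variables (g : PP -> PP) (lin_g : linF g).
Lemma linD P Q : g (P + Q) = g P + g Q. Proof. exact: lin_g.1. Qed.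
Lemma linZ (a : F) Q : g (a%:P%:P * Q) = a%:P%:P * g Q. Proof. exact: lin_g.2. Qed.
Lemma lin0 : g 0 = 0.
Proof. by apply: (addrI (g 0)); rewrite -linD !addr0. Qed.
Lemma linN P : g (- P) = - g P.
Proof. by apply: (addrI (g P)); rewrite -linD !subrr lin0. Qed.
Lemma linB P Q : g (P - Q) = g P - g Q.
Proof. by rewrite linD linN. Qed.
Lemma lin_sum (I : Type) (r : seq I) (A : pred I) (G : I -> PP) :
  g (\sum_(i <- r | A i) G i) = \sum_(i <- r | A i) g (G i).
Proof. exact: (big_morph g linD lin0). Qed.
End LinTheory.

(** The F-linear map whose values on the basis x^i yhat^j are prescribed by [G i j]. *)
Definition lext (G : nat -> nat -> PP) (Q : PP) : PP :=
  csum (fun j (q : {poly F}) => csum (fun i (a : F) => (a%:P%:P : PP) * G i j) q) Q.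

Let lext_in_add G j i : {morph (fun a : F => (a%:P%:P : PP) * G i j) : a b / a + b}.
Proof. by move=> a b; rewrite !polyCD mulrDl. Qed.
Let lext_out_add G j :
  {morph (fun q : {poly F} => csum (fun i (a : F) => (a%:P%:P : PP) * G i j) q) : a b / a + b}.
Proof. by move=> a b; rewrite csumD. Qed.

Lemma lext_mono G (a : F) i j :
  lext G (a%:P%:P * (('X^i)%:P * 'X^j)) = a%:P%:P * G i j.
Proof. by rewrite /lext mulrA -polyCM csum_mono // csum_mono. Qed.

Lemma lext_lin G : linF (lext G).
Proof.
have lextD P Q : lext G (P + Q) = lext G P + lext G Q by rewrite /lext csumD.
split=> // a; elim/PP_ind => [P Q IHP IHQ|b i j].
  by rewrite mulrDr !lextD IHP IHQ mulrDr.
by rewrite mulrA -!polyCM !lext_mono !polyCM mulrA.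
Qed.

Lemma lext_basis G i j : lext G (('X^i)%:P * 'X^j) = G i j.
Proof. by have := lext_mono G 1 i j; rewrite !polyC1 !mul1r. Qed.

Lemma lin_eq0 g : linF g -> (forall i j, g (('X^i)%:P * 'X^j) = 0) -> forall Q, g Q = 0.
Proof.
move=> lg g0; elim/PP_ind => [P Q|a i j]; first by rewrite (linD lg) => -> ->; rewrite addr0.
by rewrite (linZ lg) g0 mulr0.
Qed.

End Linear.

Section Cochains.
Variables (F : fieldType) (charF0 : [pchar F] =i pred0).
Variables (h : {poly F}) (hnz : h != 0).
Local Notation PP := {poly {poly F}}.
Local Notation gam := (gcdh h).
Local Notation L := (lmulY h).
Local Notation star := (star h).
Local Notation kap := (kap h).
Local Notation dd := (dpart h).
Local Notation H := (h%:P : PP).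
Local Notation dH := (h^`()%:P : PP).
Local Notation x := ('X%:P : PP).
Local Notation h2 := (h^`N(2)).
Implicit Types (p q : {poly F}) (P Q R U V : PP) (D g : PP -> PP) (f : PP -> PP -> PP).

Definition bilF f := (forall Q, linF (f^~ Q)) /\ (forall P, linF (f P)).
Definition derA D := linF D /\ forall P Q, D (star P Q) = star (D P) Q + star P (D Q).
Definition cocyA f := bilF f /\ forall P Q R,
  (star P (f Q R) - f (star P Q) R) + (f P (star Q R) - star (f P Q) R) = 0.
Definition hochA g P Q := star P (g Q) - g (star P Q) + star (g P) Q.
Local Notation hoch := hochA.
Definition gbr D f P Q := D (f P Q) - (f (D P) Q + f P (D Q)).
Definition PhiW f : PP :=
  f 'X x - f x 'X
  - \sum_(1 <= k < size h) \sum_(1 <= i < k)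
      (h`_k)%:P%:P * star (f ('X^i)%:P x) ('X^(k - 1 - i))%:P
  + (h`_0)%:P%:P * f 1 1.
Local Notation PhiA := PhiW.

Lemma star_sumZ (I : Type) (r : seq I) (A : pred I) (G : I -> PP) Q :
  star (\sum_(i <- r | A i) G i) Q = \sum_(i <- r | A i) star (G i) Q.
Proof. by apply: (big_morph (star^~ Q)) => [P P'|]; rewrite ?starDl ?star0l. Qed.

(** The common shape of the inner sums of [PhiW] (from 1) and of [ddX] (from 0), so that [convS]
    serves as the recursion in k for both. *)
Definition conv m (c : nat -> PP) k : PP :=
  \sum_(m <= i < k) star (c i) ('X^(k - 1 - i))%:P.

Lemma convS m c k : (m <= k)%N -> conv m c k.+1 = star (conv m c k) x + c k.
Proof.
move=> le_mk; rewrite /conv big_nat_recr //= subn1 /= subnn expr0 starr1.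
congr (_ + _); rewrite star_sumZ; apply: eq_big_nat => i /andP [_ lt_ik].
rewrite starA starC -polyCM -exprSr; congr (star _ ('X^_)%:P).
by rewrite -subnDA addnC subnDA subn1 prednK // subn_gt0.
Qed.

Lemma ddX_conv k U : ddX h k U = conv 0 (fun i => ('X^i)%:P * U) k.
Proof. by rewrite /conv big_mkord; apply: eq_bigr => i _; rewrite starCM. Qed.

Lemma hoch_bil g : linF g -> bilF (hoch g).
Proof.
move=> lg; split=> Q; split=> [P P'|a P]; rewrite /hochA.
- by rewrite !starDl !(linD lg) starDl; ring.
- by rewrite !starCM !(linZ lg) starCM; ring.
- by rewrite !starDr !(linD lg) !starDr; ring.
- by rewrite !star_cr !(linZ lg) !star_cr; ring.
Qed.

Lemma hoch_cocy g : linF g -> cocyA (hoch g).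
Proof.
move=> lg; split; first exact: hoch_bil.
by move=> P Q R; rewrite /hochA !(starDr, starNr, starDl, starNl, starA); ring.
Qed.

Lemma cocyB f f' : cocyA f -> cocyA f' -> cocyA (fun P Q => f P Q - f' P Q).
Proof.
move=> [[fl fr] cf] [[fl' fr'] cf']; split.
  split=> Q; split=> [P P'|a P].
  - by rewrite (linD (fl Q)) (linD (fl' Q)); ring.
  - by rewrite (linZ (fl Q)) (linZ (fl' Q)); ring.
  - by rewrite (linD (fr Q)) (linD (fr' Q)); ring.
  - by rewrite (linZ (fr Q)) (linZ (fr' Q)); ring.
move=> P Q R; rewrite !(starBr, starBl) -[RHS](subrr 0) -{1}(cf P Q R) -(cf' P Q R).
ring.
Qed.

Lemma PhiAB f f' : PhiA (fun P Q => f P Q - f' P Q) = PhiA f - PhiA f'.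
Proof.
rewrite /PhiW; set S := \sum_(_ <= _ < _) _; set S1 := \sum_(_ <= _ < _) _.
set S2 := \sum_(_ <= _ < _) _; suff -> : S = S1 - S2 by ring.
rewrite -sumrB; apply: eq_bigr => k _; rewrite -sumrB; apply: eq_bigr => i _.
by rewrite starBl mulrBr.
Qed.

(** This is the linearization of the relation yhat x - x yhat = h in the direction (g x, g yhat).
    The inner sums telescope to [ddX] minus g(x^k); together with the constant term these rebuild
    g(h), which cancels against g(yhat x - x yhat). *)
Lemma PhiA_hoch g : linF g -> PhiA (hoch g) =
  L (g x) - g x * 'X + star (g 'X) x - x * g 'X - dd (g x).
Proof.
move=> lg; have convg k : (0 < k)%N ->
    conv 1 (fun i => hoch g ('X^i)%:P x) k = ddX h k (g x) - g ('X^k)%:P.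
  elim: k => // [[_ _|k IHk _]].
    by rewrite /conv big_geq // /ddX big_ord1 expr0 mul1r starr1 subrr.
  have -> : ddX h k.+2 (g x) = star (ddX h k.+1 (g x)) x + ('X^(k.+1))%:P * g x.
    by rewrite !ddX_conv convS.
  by rewrite convS // IHk // /hochA starBl !starC -polyCM -exprSr; ring.
have -> : PhiA (hoch g) = hoch g 'X x - hoch g x 'X
    - \sum_(1 <= k < size h) (h`_k)%:P%:P * (ddX h k (g x) - g ('X^k)%:P)
    + (h`_0)%:P%:P * hoch g 1 1.
  rewrite /PhiW; congr (_ - _ + _); apply: eq_big_nat => k /andP [k0 _].
  by rewrite -convg // /conv big_distrr.
have gh : g H = (h`_0)%:P%:P * g 1 + \sum_(1 <= k < size h) (h`_k)%:P%:P * g ('X^k)%:P.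
  rewrite -{1}[h]coefK poly_def rmorph_sum (lin_sum lg) /=.
  rewrite -(big_mkord xpredT (fun k => g (h`_k *: 'X^k)%:P)).
  rewrite big_ltn ?lt0n ?size_poly_eq0 //; congr (_ + _).
    by rewrite -mul_polyC polyCM (linZ lg) expr0.
  by apply: eq_bigr => k _; rewrite -mul_polyC polyCM (linZ lg).
have -> : \sum_(1 <= k < size h) (h`_k)%:P%:P * (ddX h k (g x) - g ('X^k)%:P)
    = dd (g x) - (g H - (h`_0)%:P%:P * g 1).
  transitivity (dd (g x) - \sum_(1 <= k < size h) (h`_k)%:P%:P * g ('X^k)%:P).
    by rewrite /dpart -sumrB; apply: eq_bigr => k _; rewrite mulrBr.
  by rewrite gh; ring.
rewrite /hochA !star1l starr1 !starX !starC star_rX.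
have -> : L x = x * 'X + H by rewrite /lmulY dxC derivX mulr1.
rewrite (linD lg); ring.
Qed.

Lemma Phi_hoch_gam g : linF g -> Idl gam (PhiA (hoch g)).
Proof.
move=> lg; rewrite PhiA_hoch // star_x; have [B ->] := dd_mod hnz (g x).
set U := g x; set V := g 'X.
have -> : L U - U * 'X + (x * V + H * kap V) - x * V - (dH * U + H * (h2%:P * kap U) + H * H * B)
  = H * (dx U + kap V - h2%:P * kap U - H * B) - dH * U by rewrite /lmulY; ring.
by apply: IdlB; [apply: Idl_hC | apply: Idl_dhC].
Qed.

End Cochains.

(** * Normal 2-cocycles and the coboundary criterion *)

Section Normalization.
Variables (F : fieldType) (charF0 : [pchar F] =i pred0).
Variables (h : {poly F}) (hnz : h != 0).
Local Notation PP := {poly {poly F}}.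
Local Notation gam := (gcdh h).
Local Notation L := (lmulY h).
Local Notation star := (star h).
Local Notation kap := (kap h).
Local Notation dd := (dpart h).
Local Notation H := (h%:P : PP).
Local Notation dH := (h^`()%:P : PP).
Local Notation x := ('X%:P : PP).
Local Notation hoch := (hochA h).
Local Notation PhiA := (PhiW h).
Local Notation cocyA := (cocyA h).
Local Notation derA := (derA h).
Local Notation h2 := (h^`N(2)).
Implicit Types (p q : {poly F}) (P Q R U V : PP) (D g : PP -> PP) (f : PP -> PP -> PP).

(** The bracket with D sends coboundaries to coboundaries, so it descends to cohomology. *)
Lemma gbrD_hoch D g P Q : derA D -> linF g ->
  gbr D (hoch g) P Q = hoch (fun R => D (g R) - g (D R)) P Q.
Proof.
move=> [lD dD] lg; rewrite /gbr /hochA !(linD lD, linN lD) !dD.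
by rewrite !(linD lg) !(starDr, starNr, starDl, starNl); ring.
Qed.

Lemma der_comm_lin D g : linF D -> linF g -> linF (fun R => D (g R) - g (D R)).
Proof.
move=> lD lg; split=> [P Q|a P].
  by rewrite !(linD lg, linD lD); ring.
by rewrite !(linZ lg, linZ lD); ring.
Qed.

Lemma gbr_cocy D f : derA D -> cocyA f -> cocyA (gbr D f).
Proof.
move=> [lD dD] [[fl fr] cf]; split.
  split=> Q; split=> [P P'|a P]; rewrite /gbr.
  - by rewrite !(linD lD, linD (fl _), linD (fr _)); ring.
  - by rewrite !(linZ lD, linZ (fl _), linZ (fr _)); ring.
  - by rewrite !(linD lD, linD (fl _), linD (fr _)); ring.
  - by rewrite !(linZ lD, linZ (fl _), linZ (fr _)); ring.
move=> P Q R.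
(* The identity for the bracket is D applied to the identity for f, minus the three identities for f
   with D applied to one argument. *)
have := congr1 D (cf P Q R); rewrite !(linD lD, linN lD, lin0 lD) !dD => eD.
have eP := cf (D P) Q R; have eQ := cf P (D Q) R; have eR := cf P Q (D R).
rewrite /gbr !dD !(linD (fl _), linD (fr _)) !(starDr, starNr, starDl, starNl).
have e0 (a b c d : PP) : a = 0 -> b = 0 -> c = 0 -> d = 0 -> a - (b + c + d) = 0.
  by move=> -> -> -> ->; ring.
by rewrite -[RHS](e0 _ _ _ _ eD eP eQ eR); ring.
Qed.

Lemma cocy1 f Q : cocyA f -> f 1 Q = star (f 1 1) Q.
Proof.
move=> [_ cf]; have := cf 1 1 Q; rewrite !star1l subrr add0r => /eqP.
by rewrite subr_eq0 => /eqP.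
Qed.

Lemma cocyr1 f P : cocyA f -> f P 1 = star P (f 1 1).
Proof.
move=> [_ cf]; have := cf P 1 1; rewrite !starr1 subrr addr0 => /eqP.
by rewrite subr_eq0 => /eqP.
Qed.

(** In the square-zero extension, the section p(x) yhat^j |-> p(X) Y^j then respects left
    multiplication by F[x] and right multiplication by yhat. *)
Definition normal f :=
  [/\ cocyA f, forall p Q, f p%:P Q = 0 & forall Q, f Q 'X = 0].

(* The cochain g says how far the F-linear section p(x) yhat^j |-> p(X) Y^j of
   the square-zero extension defined by f is from the trivial one, where
   (x, -U) and (yhat, -V) are the chosen lifts X and Y of the generators. *)
Lemma normalize f U V : cocyA f ->
  exists2 g, [/\ linF g, g x = U & g 'X = V] & normal (fun P Q => f P Q - hoch g P Q).
Proof.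
move=> cocf.
(* [G0] is forced by the vanishing at (yhat^j, yhat) and [G] by the vanishing at (x, x^i yhat^j).
   The initial value f(1, 1) makes the difference vanish at (1, 1), as f itself need not be
   unital. *)
pose fix G0 j : PP := if j is j'.+1 then G0 j' * 'X - f 'X^j' 'X + star 'X^j' V else f 1 1.
pose fix G i j {struct i} : PP := if i is i'.+1 then
  x * G i' j - f x (('X^i')%:P * 'X^j) + star U (('X^i')%:P * 'X^j) else G0 j.
pose g := lext G; have lg : linF g by apply: lext_lin.
have gG i j : g (('X^i)%:P * 'X^j) = G i j by apply: lext_basis.
have gG0 j : g 'X^j = G 0%N j by rewrite -gG expr0 mul1r.
have gx : g x = U.
  have := gG 1%N 0%N; rewrite expr1 mulr1 => -> /=.
  by rewrite mul1r (cocyr1 x cocf) starC subrr add0r starr1.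
have gX : g 'X = V.
  have := gG0 1%N; rewrite expr1 => -> /=.
  by rewrite (cocy1 'X cocf) star_rX subrr add0r star1l.
exists g => //; set f' := fun P Q => _.
have cocf' : cocyA f' by apply: cocyB => //; apply: hoch_cocy.
have [[fl fr] cf] := cocf'.
have f'x Q : f' x Q = 0.
  move: Q; apply: (lin_eq0 (fr x)) => i j.
  rewrite /f' /hochA !starC mulrA -polyCM -exprS !gG gx /=; ring.
have f'1 Q : f' 1 Q = 0.
  rewrite (cocy1 Q cocf'); suff -> : f' 1 1 = 0 by rewrite star0l.
  have g1 : g 1 = f 1 1 by have := gG0 0%N; rewrite expr0.
  by rewrite /f' /hochA !star1l starr1 g1; ring.
have f'xi i Q : f' ('X^i)%:P Q = 0.
  elim: i => [|i IHi]; first exact: f'1.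
  have := cf x ('X^i)%:P Q; rewrite !f'x IHi starr0 star0l subrr addr0 sub0r.
  by rewrite starC -polyCM -exprS => /eqP; rewrite oppr_eq0 => /eqP.
have f'p p Q : f' p%:P Q = 0.
  rewrite -[p]coefK poly_def rmorph_sum (lin_sum (fl Q)) big1 // => i _.
  by rewrite /= -mul_polyC polyCM (linZ (fl Q)) f'xi mulr0.
split=> // Q; move: Q; apply: (lin_eq0 (fl 'X)) => i j.
have f'Xj : f' 'X^j 'X = 0.
  by rewrite /f' /hochA !star_rX -exprSr !gG0 gX /=; ring.
have := cf ('X^i)%:P 'X^j 'X.
rewrite !f'p f'Xj starr0 star0l subrr addr0 sub0r starC => /eqP.
by rewrite oppr_eq0 => /eqP.
Qed.

Section Normal.
Variables (f : PP -> PP -> PP) (nf : normal f).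
Local Notation a0 := (f 'X x).

Let cf : cocyA f := let: And3 c _ _ := nf in c.
Let fp p Q : f p%:P Q = 0.
Proof. by case: nf. Qed.
Let fX Q : f Q 'X = 0.
Proof. by case: nf. Qed.
Let fl Q : linF (f^~ Q) := cf.1.1 Q.
Let fr P : linF (f P) := cf.1.2 P.

Lemma normal_Phi : PhiA f = a0.
Proof.
rewrite /PhiW !fp ?(fp 1) mulr0 addr0 subr0 big1 ?subr0 // => k _.
by rewrite big1 // => i _; rewrite fp star0l mulr0.
Qed.

Let f_1 P : f P 1 = 0.
Proof. by rewrite (cocyr1 P cf) (fp 1) starr0. Qed.

Lemma normal_pP p P Q : f (p%:P * P) Q = p%:P * f P Q.
Proof.
have := cf.2 p%:P P Q; rewrite !fp star0l subrr addr0 !starC => /eqP.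
by rewrite subr_eq0 => /eqP.
Qed.

Let f_LX p Q : f (L p%:P) Q = p%:P * f 'X Q.
Proof. by rewrite /lmulY dxC -polyCM (linD (fl Q)) fp addr0 normal_pP. Qed.

Lemma normal_XpQ p Q : f 'X (p%:P * Q) = p%:P * f 'X Q + star (f 'X p%:P) Q.
Proof.
have := cf.2 'X p%:P Q; rewrite fp starr0 starX f_LX starC => e.
by rewrite -[RHS]addr0 -e; ring.
Qed.

Lemma normal_QX P Q : f P (Q * 'X) = f P Q * 'X.
Proof.
have := cf.2 P Q 'X; rewrite !fX starr0 subrr add0r !star_rX => /eqP.
by rewrite subr_eq0 => /eqP.
Qed.

Lemma normal_Xxp p : f 'X (x * p%:P) = x * f 'X p%:P + a0 * p%:P + (star a0 p%:P - a0 * p%:P).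
Proof. by rewrite normal_XpQ; ring. Qed.

(** By [normal_Xxp], f(yhat, -) obeys the Leibniz rule in x up to a multiple of h, with value [a0]
    at x. *)
Lemma normal_Xp p : Idl gam (f 'X p%:P - a0 * p^`()%:P).
Proof.
elim/poly_ind: p => [|p c IHp].
  by rewrite deriv0 polyC0 mulr0 subr0 (lin0 (fr _)); apply: Idl0.
have -> : (p * 'X + c%:P)%:P = x * p%:P + c%:P%:P * 1.
  by rewrite mulr1 polyCD polyCM mulrC.
rewrite (linD (fr _)) (linZ (fr _)) f_1 mulr0 addr0 normal_Xxp.
rewrite derivD derivM derivX derivC mulr1 addr0 polyCD polyCM.
have -> : x * f 'X p%:P + a0 * p%:P + (star a0 p%:P - a0 * p%:P)
    - a0 * (p^`()%:P * 'X%:P + p%:P) =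
  x * (f 'X p%:P - a0 * p^`()%:P) + (star a0 p%:P - a0 * p%:P) by ring.
by apply: IdlD; [apply: IdlMl | apply: star_comm_gam].
Qed.

Lemma normal_XQ Q : Idl gam (f 'X Q - a0 * dx Q).
Proof.
elim/poly_ind: Q => [|Q p IHQ].
  by rewrite dx0 mulr0 subr0 (lin0 (fr _)); apply: Idl0.
rewrite (linD (fr _)) normal_QX dxD dxM dxX dxC mulr0 addr0.
have -> : f 'X Q * 'X + f 'X p%:P - a0 * (dx Q * 'X + p^`()%:P) =
  (f 'X Q - a0 * dx Q) * 'X + (f 'X p%:P - a0 * p^`()%:P) by ring.
by apply: IdlD; [apply: IdlMr | apply: normal_Xp].
Qed.

Lemma normal_Qx Q : Idl gam (f Q x - a0 * Q^`()).
Proof.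
elim/poly_ind: Q => [|Q p IHQ].
  by rewrite deriv0 mulr0 subr0 (lin0 (fl _)); apply: Idl0.
rewrite (linD (fl _)) fp addr0 derivD derivM derivX derivC addr0 mulr1.
have -> : f (Q * 'X) x = f (L Q) x - H * f (dx Q) x.
  by rewrite /lmulY (linD (fl _)) normal_pP addrK.
(* The cocycle identity at (yhat, Q, x) computes f(yhat Q, x) from f(Q, x). Modulo [gam] the only
   new term is a0 Q, as the Leibniz rule in yhat demands. *)
have := cf.2 'X Q x; rewrite !starX star_x (linD (fr _)) normal_XpQ star_x => e.
have -> : f (L Q) x = L (f Q x) + (f 'X (H * kap Q) + star a0 Q - H * kap (f 'X Q)).
  by rewrite -[LHS]addr0 -e; ring.
have -> : L (f Q x) + (f 'X (H * kap Q) + star a0 Q - H * kap (f 'X Q))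
    - H * f (dx Q) x - a0 * (Q^`() * 'X + Q) =
  (f Q x - a0 * Q^`()) * 'X + ((f 'X (H * kap Q) - a0 * dx (H * kap Q))
   + (star a0 Q - a0 * Q) + (H * (dx (f Q x) - kap (f 'X Q) - f (dx Q) x + a0 * dx (kap Q))
   + dH * (a0 * kap Q))).
  by rewrite /lmulY dxM dxC; ring.
apply: IdlD; first exact: IdlMr.
apply: IdlD; first by apply: IdlD; [apply: normal_XQ | apply: star_comm_gam].
by apply: IdlD; [apply: Idl_hC | apply: Idl_dhC].
Qed.

(** The cocycle identity recovers f from the single value [a0]: first f(yhat, p), then f(yhat, Q),
    then f(P, Q) by induction on the degree of P in yhat. This reflects the presentation of A by one
    relation. *)
Lemma normal_eq0 : a0 = 0 -> forall P Q, f P Q = 0.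
Proof.
move=> a00.
have fXp p : f 'X p%:P = 0.
  elim/poly_ind: p => [|p c IHp]; first by rewrite polyC0 (lin0 (fr _)).
  have -> : (p * 'X + c%:P)%:P = x * p%:P + c%:P%:P * 1.
    by rewrite mulr1 polyCD polyCM mulrC.
  by rewrite (linD (fr _)) (linZ (fr _)) f_1 normal_Xxp IHp a00 star0l; ring.
have fXQ Q : f 'X Q = 0.
  elim/poly_ind: Q => [|Q p IHQ]; first by rewrite (lin0 (fr _)).
  by rewrite (linD (fr _)) normal_QX IHQ fXp mul0r addr0.
elim/poly_ind => [|P p IHP] Q; first by rewrite (lin0 (fl _)).
rewrite (linD (fl _)) fp addr0.
have := cf.2 P 'X Q; rewrite fXQ starr0 fX star0l starX IHP star_rX subr0 addr0 sub0r.
by move/eqP; rewrite oppr_eq0 => /eqP.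
Qed.

End Normal.

(* The image of the coboundaries under [PhiW] is the whole ideal gcd(h,h') A:
   multiples of h come from V, by surjectivity of kap, those of h' from U. *)
Lemma solve_gam B : exists U V,
  L U - U * 'X + star V x - x * V - dd U = gam%:P * B.
Proof.
have [s [t est]] := gam_bezout h; pose U := - (t%:P * B).
have [C eC] := dd_mod hnz U.
have [V eV] := kap_surj charF0 h (s%:P * B - dx U + h2%:P * kap U + H * C).
exists U, V; rewrite star_x eV eC {1}est polyCD !polyCM /lmulY /U; ring.
Qed.

(** Normalizing with the lifts supplied by [solve_gam] makes the defect zero, and a normal cocycle
    with zero defect vanishes. *)
Lemma Phi_gam_coboundary f : cocyA f -> Idl gam (PhiA f) ->
  exists2 g, linF g & forall P Q, f P Q = hoch g P Q.
Proof.
move=> cf [B eB]; have [U [V eUV]] := solve_gam B.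
have [g [lg gx gX] nf] := normalize U V cf; exists g => // P Q.
apply/eqP; rewrite -subr_eq0; apply/eqP.
apply: (normal_eq0 nf); rewrite -(normal_Phi nf) PhiAB (PhiA_hoch hnz lg).
by rewrite gx gX eUV eB subrr.
Qed.

End Normalization.

Section Derivations.
Variables (F : fieldType) (charF0 : [pchar F] =i pred0).
Variables (h : {poly F}) (hnz : h != 0).
Local Notation PP := {poly {poly F}}.
Local Notation gam := (gcdh h).
Local Notation pi := (pih h).
Local Notation w := (wh h).
Local Notation L := (lmulY h).
Local Notation star := (star h).
Local Notation kap := (kap h).
Local Notation dd := (dpart h).
Local Notation H := (h%:P : PP).
Local Notation dH := (h^`()%:P : PP).
Local Notation x := ('X%:P : PP).
Local Notation hoch := (hochA h).
Local Notation PhiA := (PhiW h).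
Local Notation cocyA := (cocyA h).
Local Notation derA := (derA h).
Local Notation h2 := (h^`N(2)).
Implicit Types (p q : {poly F}) (P Q R U V : PP) (D g : PP -> PP) (f : PP -> PP -> PP).

(** * The action of a derivation on HH^2 *)

Section Derivation.
Variables (D : PP -> PP) (derD : derA D).
Local Notation u := (D x).
Local Notation v := (D 'X).
Let lD : linF D := derD.1.

Lemma der1 : D 1 = 0.
Proof.
have := derD.2 1 1; rewrite star1l starr1 star1l => /eqP.
by rewrite -subr_eq0 opprD addNKr oppr_eq0 => /eqP.
Qed.

Lemma der_C p : Idl h (D p%:P - p^`()%:P * u).
Proof.
elim/poly_ind: p => [|p c IHp].
  by rewrite deriv0 polyC0 mul0r subr0 (lin0 lD); apply: Idl0.
have -> : (p * 'X + c%:P)%:P = star x p%:P + c%:P%:P * 1.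
  by rewrite starC mulr1 polyCD polyCM mulrC.
rewrite (linD lD) (linZ lD) der1 derD.2 starC.
rewrite derivD derivM derivX derivC mulr1 addr0 polyCD polyCM mulr0 addr0.
have -> : star u p%:P + x * D p%:P - (p^`()%:P * x + p%:P) * u =
  (star u p%:P - u * p%:P) + x * (D p%:P - p^`()%:P * u) by ring.
by apply: IdlD; [apply: star_comm | apply: IdlMl].
Qed.

(** As the product is commutative modulo h, a derivation acts there as the vector field u d/dx + v
    d/dyhat. *)
Lemma der_mod Q : Idl h (D Q - (u * dx Q + v * Q^`())).
Proof.
elim/poly_ind: Q => [|Q p IHQ].
  by rewrite deriv0 dx0 !mulr0 addr0 subr0 (lin0 lD); apply: Idl0.
rewrite (linD lD) -{1}(star_rX h) derD.2 star_rX dxD dxM dxX dxC derivD derivM derivX derivC.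
have -> : D Q * 'X + star Q v + D p%:P -
   (u * (dx Q * 'X + Q * 0 + p^`()%:P) + v * (Q^`() * 'X + Q * 1 + 0)) =
  (D Q - (u * dx Q + v * Q^`())) * 'X + (star Q v - Q * v) + (D p%:P - p^`()%:P * u).
  by ring.
apply: IdlD; last exact: der_C.
by apply: IdlD; [apply: IdlMr | apply: star_comm].
Qed.

(* [PhiW] of the zero coboundary of D: D is compatible with the relation
   [yhat x - x yhat = h]. *)
Lemma der_rel : L u - u * 'X + star v x - x * v - dd u = 0.
Proof.
rewrite -(PhiA_hoch hnz lD).
have h0 P Q : hoch D P Q = 0 by rewrite /hochA derD.2; ring.
rewrite /PhiW !h0 mulr0 addr0 subr0 big1 ?subr0 // => k _.
by rewrite big1 // => i _; rewrite h0 star0l mulr0.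
Qed.

(** By [der_rel], h divides h' u. Cancelling the common factor of h and h' shows that pi divides w
    u, and w is coprime to pi. *)
Lemma der_x_pi : exists u1, u = pi%:P * u1.
Proof.
have [B eB] := dd_mod hnz u.
have e : dH * u = H * (dx u + kap v - h2%:P * kap u - H * B).
  have := der_rel; rewrite star_x eB /lmulY => e.
  by rewrite -[LHS]addr0 -e; ring.
suff : Idl pi u by [].
apply: (Idl_gauss (coprime_pi_wh hnz)); first exact: IdlC.
apply: (@Idl_cancel _ (lcc h * gam)).
  by rewrite mulf_neq0 ?lcc_neq0 ?gam_neq0.
by rewrite mulrA -polyCM -(dhE hnz) e mulrAC -(hE hnz); apply: IdlC.
Qed.

(* The divergence of D modulo h is read off by dividing [der_rel] by h. *)
Lemma der_div u1 : u = pi%:P * u1 ->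
  Idl h (w%:P * u1 - (dx u + kap v - h2%:P * kap u)).
Proof.
move=> eu; have [B eB] := dd_mod hnz u.
have e : dH * u = H * (dx u + kap v - h2%:P * kap u - H * B).
  have := der_rel; rewrite star_x eB /lmulY => e.
  by rewrite -[LHS]addr0 -e; ring.
have nzH : H != 0 by rewrite polyC_eq0.
exists (- B); apply: (mulfI nzH).
have eH : H = (lcc h * pi * gam)%:P by rewrite -(hE hnz).
have ew : H * (w%:P * u1) = dH * u.
  by rewrite eu (dhE hnz) eH !polyCM; ring.
by rewrite mulrBr ew e; ring.
Qed.

Lemma der_div_gam u1 : u = pi%:P * u1 ->
  Idl gam (w%:P * u1 - (dx u + v^`() - h2%:P * u^`())).
Proof.
move=> eu; have -> : w%:P * u1 - (dx u + v^`() - h2%:P * u^`()) =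
   (w%:P * u1 - (dx u + kap v - h2%:P * kap u)) + ((kap v - v^`()) - h2%:P * (kap u - u^`())).
  by ring.
apply: IdlD; first exact/(Idl_h_gam hnz)/der_div.
by apply: IdlB; [|apply: IdlMl]; apply: kap_deriv.
Qed.

(** Normality reduces the defect of [D, f] to D a - f(v, x) - f(yhat, u) plus the sum over the
    powers of x. Each term is known modulo [gam], and the divergence of D assembles from the
    derivatives of u and v. *)
Lemma gbr_normal f u1 : normal h f -> u = pi%:P * u1 ->
  let a := f 'X x in
  Idl gam (PhiA (gbr D f) - (u * dx a + v * a^`() - a * (w%:P * u1))).
Proof.
move=> nf eu a; have [cf fp fX] := nf; have [[fl fr] _] := cf.
pose c i := f (D ('X^i)%:P) x.
have ePhi : PhiA (gbr D f) = D a - f v x - f 'X u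
    + \sum_(1 <= k < size h) (h`_k)%:P%:P * conv h 1 c k.
  rewrite /PhiW /gbr !fp !fX ?(fp 1) der1 (lin0 (fl _)) (lin0 lD).
  have -> : \sum_(1 <= k < size h) \sum_(1 <= i < k) (h`_k)%:P%:P
      * star (D (f ('X^i)%:P x) - (f (D ('X^i)%:P) x + f ('X^i)%:P u)) ('X^(k - 1 - i))%:P
    = - \sum_(1 <= k < size h) (h`_k)%:P%:P * conv h 1 c k.
    rewrite -sumrN; apply: eq_bigr => k _; rewrite /conv big_distrr -sumrN.
    apply: eq_bigr => i _; by rewrite !fp (lin0 lD) addr0 sub0r starNl mulrN /c /=.
  rewrite -/a. ring.
(* Modulo [gam], f(D x^i, x) is a times the yhat-derivative of D x^i, that is, a i x^(i-1) du/dyhat;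
   the sum over i < k yields the divided second derivative of x^k. *)
have conv_mod k : (0 < k)%N -> Idl gam (conv h 1 c k - a * u^`() * ('X^k)^`N(2)%:P).
  elim: k => // [[_ _|k IHk _]].
    rewrite /conv big_geq // nderivn_poly0 ?size_polyXn // mulr0 subr0; exact: Idl0.
  have {1}-> : 'X^(k.+2) = 'X^(k.+1) * 'X + 0%:P :> {poly F} by rewrite addr0 -exprSr.
  rewrite convS // nderivnMXaddC nderivn1 polyCD polyCM.
  set X1 := 'X^(k.+1) in IHk *; set C := conv h 1 c k.+1 in IHk *.
  have -> : star C x + c k.+1 - a * u^`() * (X1^`()%:P + X1^`N(2)%:P * x) =
     (star C x - C * x) + (C - a * u^`() * X1^`N(2)%:P) * x
     + (c k.+1 - a * (D X1%:P)^`())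
     + a * (D X1%:P - X1^`()%:P * u)^`().
    by rewrite derivB derivM derivC; ring.
  apply: IdlD; last first.
    by apply/IdlMl/(Idl_h_gam hnz)/Idl_deriv/der_C.
  apply: IdlD; last exact: normal_Qx.
  by apply: IdlD; [apply: star_comm_gam | apply/IdlMr/IHk].
have conv_sum : Idl gam (\sum_(1 <= k < size h) (h`_k)%:P%:P * conv h 1 c k
    - a * u^`() * h2%:P).
  rewrite (linear_h hnz (G := nderivn 2)); last exact: (nderivnC 1 2).
  rewrite rmorph_sum big_distrr -sumrB /= big_seq_cond; apply: Idl_sum => k.
  rewrite andbT mem_index_iota => /andP [k0 _].
  have -> : (h`_k)%:P%:P * conv h 1 c k - a * u^`() * ((h`_k)%:P * ('X^k)^`N(2))%:P =
     (h`_k)%:P%:P * (conv h 1 c k - a * u^`() * ('X^k)^`N(2)%:P).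
    by rewrite polyCM; ring.
  exact/IdlMl/conv_mod.
rewrite ePhi; set S := \sum_(_ <= _ < _) _ in conv_sum *.
have -> : D a - f v x - f 'X u + S - (u * dx a + v * a^`() - a * (w%:P * u1)) =
    (D a - (u * dx a + v * a^`())) - (f v x - a * v^`()) - (f 'X u - a * dx u)
    + (S - a * u^`() * h2%:P) + a * (w%:P * u1 - (dx u + v^`() - h2%:P * u^`())).
  by ring.
apply: IdlD; last exact/IdlMl/der_div_gam.
apply: IdlD => //.
apply: IdlB; last exact: normal_XQ.
by apply: IdlB; [apply/(Idl_h_gam hnz)/der_mod | apply: normal_Qx].
Qed.

Lemma der_gam u1 B : u = pi%:P * u1 -> Idl gam (u * dx (gam%:P * B)).
Proof.
move=> ->; rewrite dxM dxC.
have -> : pi%:P * u1 * (gam^`()%:P * B + gam%:P * dx B) =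
  (gam^`() * pi)%:P * (u1 * B) + gam%:P * (pi%:P * u1 * dx B) by rewrite polyCM; ring.
by rewrite dgamE // polyCM -mulrA; apply: IdlD; apply: IdlC.
Qed.

(** Replacing f by a normal cocycle changes [D, f] by a coboundary only. The representative a is
    free because D maps [gam] A into itself modulo [gam], by [der_gam]. *)
Lemma Phi_gbr f u1 a : cocyA f -> u = pi%:P * u1 -> Idl gam (PhiA f - a) ->
  Idl gam (PhiA (gbr D f) - (u * dx a + v * a^`() - a * (w%:P * u1))).
Proof.
move=> cf eu fa; have [g [lg gx gX] nf] := normalize 0 0 cf.
set f' := (fun P Q => _) in nf.
have [B eB] : Idl gam (f' 'X x - a).
  rewrite -(normal_Phi nf) PhiAB addrAC.
  by apply: IdlB => //; apply: Phi_hoch_gam.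
have := gbr_normal nf eu; set a0 := f' 'X x => /= main.
have ea : a = a0 - gam%:P * B by rewrite -eB opprB addrC subrK.
have -> : PhiA (gbr D f) - (u * dx a + v * a^`() - a * (w%:P * u1)) =
   PhiA (fun P Q => gbr D f P Q - gbr D f' P Q)
   + (PhiA (gbr D f') - (u * dx a0 + v * a0^`() - a0 * (w%:P * u1)))
   + u * dx (gam%:P * B) + gam%:P * (v * B^`() - B * (w%:P * u1)).
  by rewrite PhiAB ea dxB derivB [(gam%:P * B)^`()]derivM derivC; ring.
apply: IdlD; last exact: IdlC.
apply: IdlD; last exact: der_gam eu.
apply: IdlD => //.
have -> : PhiA (fun P Q => gbr D f P Q - gbr D f' P Q) =
    PhiA (hoch (fun R => D (g R) - g (D R))).
  have e P Q : gbr D f P Q - gbr D f' P Q = hoch (fun R => D (g R) - g (D R)) P Q.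
    rewrite -(gbrD_hoch _ _ derD lg) /gbr /f' (linB lD); ring.
  rewrite /PhiW !e; congr (_ - _ + _).
  by apply: eq_bigr => k _; apply: eq_bigr => i _; rewrite e.
by apply: Phi_hoch_gam => //; apply: der_comm_lin.
Qed.

End Derivation.

End Derivations.

(** * The derivations ad (g a_n) on generators, and the center *)

Section CenterAction.
Variables (F : fieldType) (charF0 : [pchar F] =i pred0).
Variables (h : {poly F}) (hnz : h != 0).
Local Notation PP := {poly {poly F}}.
Local Notation gam := (gcdh h).
Local Notation pi := (pih h).
Local Notation w := (wh h).
Local Notation L := (lmulY h).
Local Notation star := (star h).
Local Notation kap := (kap h).
Local Notation dH := (h^`()%:P : PP).
Local Notation x := ('X%:P : PP).
Local Notation hoch := (hochA h).
Local Notation PhiA := (PhiW h).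
Local Notation cocyA := (cocyA h).
Local Notation derA := (derA h).
Local Notation h2 := (h^`N(2)).
Implicit Types (p q : {poly F}) (P Q R U V : PP) (D g : PP -> PP) (f : PP -> PP -> PP).

Local Notation rho := (pi^`() - w).

(** The polynomial form of [delta0], see [delta0E]. *)
Definition deltap p : {poly F} := (p * pi)^`() - p * w.
Local Notation delta := deltap.

Lemma deltaE p : delta p = p^`() * pi + p * rho.
Proof. by rewrite /deltap derivM mulrBr addrA. Qed.

(* [hy m] is h^m y^m, see [hy_pow]. *)
Fixpoint hy m : PP := if m is m'.+1 then L (hy m') - m'.+1%:R * dH * hy m' else 1.

(** The values of ad (p a_n) on the two generators. For n = 0 the factor n makes the truncated index
    [n.-1] harmless. *)
Definition ad_spec p n (E : PP -> PP) :=
  [/\ derA E, E x = n%:R * ((p * pi)%:P * hy n.-1) &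
     E 'X = - ((delta p)%:P * hy n + (p * pi)%:P * dx (hy n))].

Lemma Idl_pigam Q : Idl (pi * gam) Q -> Idl h Q.
Proof.
move=> [B ->]; exists ((lead_coef (h %/ gcdh h))^-1%:P%:P * B).
have -> : h%:P = (lcc h * pi * gam)%:P by rewrite -(hE hnz).
rewrite /lcc !polyCM; set c := lead_coef _.
have : c%:P%:P * c^-1%:P%:P = 1 :> PP by rewrite -!polyCM divff ?lc_neq0.
move=> e; rewrite -[LHS]mul1r -e; ring.
Qed.

Lemma Idl_h_pi Q : Idl h (pi%:P * Q) -> Idl gam Q.
Proof.
rewrite {1}(hE hnz) => hQ; apply: (@Idl_cancel _ pi); first exact: pi_neq0.
by apply: (@Idl_trans _ _ (lcc h)); rewrite mulrC mulrA.
Qed.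

Lemma Idl_two d Q : Idl d (2%:R * Q) -> Idl d Q.
Proof.
have [c c2] := natr_unit_poly charF0 1 => dQ.
have -> : Q = c%:P * (2%:R * Q).
  by rewrite mulrA -(rmorph_nat (@polyC _)) -polyCM c2 mul1r.
exact: IdlMl.
Qed.

(** Differentiating h' = lcc gam w leaves one term without an explicit factor [gam], and that term
    contains pi gam', a multiple of [gam] by [dgamE]. *)
Lemma pi_ddh : Idl gam (pi * h^`()^`())%:P.
Proof.
have -> : pi * h^`()^`() = gam * (lcc h * ((w - pi^`()) * w + pi * w^`())).
  transitivity (lcc h * (gam^`() * pi * w + gam * (pi * w^`()))).
    by rewrite (dhE hnz) !derivM [(lcc h)^`()]derivC; ring.
  by rewrite dgamE //; ring.
by rewrite polyCM; apply: IdlC.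
Qed.

(** * Central derivations *)

Section Center.
Variables (D : PP -> PP) (derD : derA D).
Hypothesis central : forall p n, exists2 E, ad_spec p n E &
  exists c, forall Q, D (E Q) - E (D Q) = star c Q - star Q c.
Local Notation u := (D x).
Local Notation v := (D 'X).

(* Commutators lie in h A, so an inner bracket vanishes modulo h. *)
Lemma bracket_mod E Q : derA E -> (exists c, forall Q, D (E Q) - E (D Q) = star c Q - star Q c) ->
  Idl h ((u * dx (E Q) + v * (E Q)^`()) - (E x * dx (D Q) + E 'X * (D Q)^`())).
Proof.
move=> dE [c eDE].
have -> : u * dx (E Q) + v * (E Q)^`() - (E x * dx (D Q) + E 'X * (D Q)^`()) =
  (star c Q - c * Q) - (star Q c - Q * c)
   - (D (E Q) - (u * dx (E Q) + v * (E Q)^`()))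
   + (E (D Q) - (E x * dx (D Q) + E 'X * (D Q)^`())).
  have -> : star c Q = star Q c + (D (E Q) - E (D Q)) by rewrite eDE; ring.
  by ring.
apply: IdlD; last exact: der_mod.
apply: IdlB; last exact: der_mod.
by apply: IdlB; apply: star_comm.
Qed.

(** Here ad (p a_0) kills x and sends yhat to -delta(p); the two claims are the bracket with D
    evaluated at x and at yhat. *)
Lemma central0 p : Idl h ((delta p)%:P * u^`()) /\
  Idl h (u * (delta p)^`()%:P - (delta p)%:P * v^`()).
Proof.
have [E [dE ex ey] inn] := central p 0; move: ex ey; rewrite /= mul0r mulr1 => ex ey.
have ey' : E 'X = - (delta p)%:P by rewrite ey -[1]/(1%:P) dxC derivC mulr0 addr0.
split.
  have := bracket_mod x dE inn; rewrite ex ey' dx0 deriv0.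
  by have -> : u * 0 + v * 0 - (0 * dx u + - (delta p)%:P * u^`()) = (delta p)%:P * u^`() by ring.
have := bracket_mod 'X dE inn; rewrite ex ey' dxN dxC derivN derivC => /IdlN.
have -> // : - (u * - (delta p)^`()%:P + v * - 0 - (0 * dx v + - (delta p)%:P * v^`())) =
  u * (delta p)^`()%:P - (delta p)%:P * v^`() by ring.
Qed.

Lemma central1 p : Idl h (u * (p * pi)^`()%:P - (p * pi)%:P * dx u) /\
  Idl gam (v * (delta p)%:P + (p * pi)%:P * dx v).
Proof.
have [u1 eu] := der_x_pi hnz derD.
have [a0 b0] := central0 p.
have [E [dE ex ey] inn] := central p 1; move: ex ey.
have -> : hy 1 = 'X - dH by rewrite /= /lmulY -[1]/(1%:P) dxC derivC; ring.
rewrite /= mul1r mulr1 dxB dxX dxC sub0r => ex ey.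
split.
  have du : u^`() = pi%:P * u1^`() by rewrite eu derivM derivC mul0r add0r.
  (* The terms in du/dyhat drop out modulo h: one by [central0], the other because pi divides
     du/dyhat and [gam] divides pi h''. *)
  have -> : u * (p * pi)^`()%:P - (p * pi)%:P * dx u =
     (u * dx (E x) + v * (E x)^`() - (E x * dx u + E 'X * u^`()))
     - (('X - dH) * ((delta p)%:P * u^`()) - p%:P * ((pi * h^`()^`())%:P * (pi%:P * u1^`()))).
    by rewrite -du ex ey dxC derivC !polyCM; ring.
  apply: IdlB; first exact: bracket_mod.
  apply: IdlB; apply: IdlMl => //; apply: Idl_pigam.
  by rewrite mulrC; apply: IdlM2; [apply: pi_ddh | apply: IdlC].
have [B eB] := pi_ddh.
have [b eb] : Idl gam (E 'X + (delta p)%:P * 'X).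
  have -> : E 'X + (delta p)%:P * 'X = dH * (delta p)%:P + p%:P * (pi * h^`()^`())%:P.
    by rewrite ey !polyCM; ring.
  by apply: IdlD; [apply: Idl_dhC | apply/IdlMl/pi_ddh].
have := Idl_h_gam hnz (bracket_mod 'X dE inn).
have {}ey : E 'X = gam%:P * b - (delta p)%:P * 'X by rewrite -eb addrK.
rewrite ex ey dxB derivB [dx ((delta p)%:P * 'X)]dxM dxX dxC.
rewrite [((delta p)%:P * 'X)^`()]derivM derivX derivC.
rewrite [(gam%:P * b)^`()]derivM derivC => br.
have -> : v * (delta p)%:P + (p * pi)%:P * dx v =
   - (u * (dx (gam%:P * b) - ((delta p)^`()%:P * 'X + (delta p)%:P * 0)) +
       v * (0 * b + gam%:P * b^`() - (0 * 'X + (delta p)%:P * 1)) -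
       ((p * pi)%:P * dx v + (gam%:P * b - (delta p)%:P * 'X) * v^`()))
   + u * dx (gam%:P * b) - 'X * (u * (delta p)^`()%:P - (delta p)%:P * v^`())
   + gam%:P * (v * b^`() - b * v^`()) by ring.
apply: IdlD; last exact: IdlC.
apply: IdlB; last exact/IdlMl/(Idl_h_gam hnz).
by apply: IdlD; [apply: IdlN | apply: der_gam eu].
Qed.

(** The cases p = 1 and p = x of [central1] combine to pi v = gam b. Differentiating this and
    inserting the case p = 1 shows that pi divides pi' b; since pi is separable it divides b, and
    cancelling pi leaves v in [gam] A. *)
Lemma central_v : Idl gam v.
Proof.
have [_ [s es]] := central1 1; have [_ ex] := central1 'X.
have {}es : v * rho%:P + pi%:P * dx v = gam%:P * s.
  by rewrite -es deltaE -[1]/(1%:P) derivC !mul1r mul0r add0r.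
have [b eb] : Idl gam (pi%:P * v).
  have -> : pi%:P * v = (v * (delta 'X)%:P + ('X * pi)%:P * dx v) - gam%:P * (x * s).
    by rewrite [gam%:P * _]mulrCA -es deltaE derivX !polyCD !polyCM; ring.
  by apply: IdlB => //; apply: IdlC.
have nzg : gam%:P != 0 :> PP by rewrite polyC_eq0 gam_neq0.
have nzp : pi%:P != 0 :> PP by rewrite polyC_eq0 pi_neq0.
have eg : gam^`()%:P * pi%:P = - gam%:P * rho%:P.
  by rewrite -polyCM dgamE // !polyCM !polyCB; ring.
have db : pi^`()%:P * v + pi%:P * dx v = gam^`()%:P * b + gam%:P * dx b.
  by rewrite -!dxC -!dxM eb.
have eb' : pi^`()%:P * b = pi%:P * (dx b - s).
  apply: (mulfI nzg).
  have -> : gam%:P * (pi^`()%:P * b) = pi^`()%:P * (pi%:P * v) by rewrite eb; ring.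
  have -> : gam%:P * (pi%:P * (dx b - s)) =
     pi%:P * (gam^`()%:P * b + gam%:P * dx b) - (gam^`()%:P * pi%:P) * b - pi%:P * (gam%:P * s).
    by ring.
  rewrite -db eg -es; have -> : - gam%:P * rho%:P * b = - rho%:P * (pi%:P * v) by rewrite eb; ring.
  by ring.
have [b1 eb1] : Idl pi b.
  apply: (Idl_gauss (coprime_pi_dpi hnz)); first exact: IdlC.
  by rewrite eb'; apply: IdlC.
by exists b1; apply: (mulfI nzp); rewrite eb eb1; ring.
Qed.

Lemma central_u u1 : u = pi%:P * u1 -> Idl gam u /\ Idl h (u * rho%:P).
Proof.
move=> eu; have [v1 ev] := central_v.
have dv : Idl gam v^`() by apply/Idl_deriv/central_v.
have ud p : Idl gam (u * (delta p)^`()%:P).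
  have [_ /(Idl_h_gam hnz) e] := central0 p.
  rewrite -[u * _](subrK ((delta p)%:P * v^`())); apply: IdlD => //; exact: IdlMl.
have d1 : (delta 1)^`() = rho^`().
  by rewrite deltaE -[1]/(1%:P) derivC mul0r add0r mul1r.
have dX : (delta 'X)^`() = pi^`() + rho + 'X * rho^`().
  by rewrite deltaE derivX mul1r [LHS]derivD derivM derivX mul1r addrA.
have dXX : (delta ('X * 'X))^`() = 2%:R * pi + 2%:R * 'X * (pi^`() + rho) + 'X * 'X * rho^`().
  have dX2 : ('X * 'X)^`() = 'X + 'X :> {poly F} by rewrite derivM derivX; ring.
  rewrite deltaE dX2 [LHS]derivD !derivM [('X + 'X)^`()]derivD !derivX; ring.
(* The second difference of delta(p)' over p = 1, x, x^2 is 2 pi. *)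
have upi : Idl gam (pi%:P * u).
  apply: Idl_two.
  have -> : 2%:R * (pi%:P * u) = u * (delta ('X * 'X))^`()%:P
     - 2%:R * x * (u * (delta 'X)^`()%:P) + x * x * (u * (delta 1)^`()%:P).
    by rewrite d1 dX dXX; ring.
  by apply: IdlD; [apply: IdlB => // |]; apply: IdlMl.
(* Subtracting pi times the divergence relation from the case p = 1 of [central1] cancels pi dx u;
   the terms left over are multiples of pi gam, which is h up to a scalar. *)
have urho : Idl h (u * rho%:P).
  have [c1 _] := central1 1.
  have kv : Idl h (pi%:P * kap v).
    by apply: Idl_pigam; rewrite ev kapCM; apply: IdlM2; [exists 1; rewrite mulr1|apply: IdlC].
  have ku : Idl h (pi%:P * (h2%:P * kap u)).
    apply: Idl_two; apply: Idl_pigam; rewrite eu kapCM.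
    have -> : 2%:R * (pi%:P * (h2%:P * (pi%:P * kap u1))) =
       pi%:P * kap u1 * (pi * h^`()^`())%:P.
      have -> : h^`()^`() = h2 *+ 2 by rewrite -(nderivn_def 2).
      by rewrite polyCM rmorphMn; ring.
    by apply: IdlM2; [apply: IdlC | apply: pi_ddh].
  have dv' := der_div hnz derD eu.
  have -> : u * rho%:P = (u * (1 * pi)^`()%:P - (1 * pi)%:P * dx u)
     - (pi%:P * (w%:P * u1 - (dx u + kap v - h2%:P * kap u)))
     - pi%:P * kap v + pi%:P * (h2%:P * kap u).
    by rewrite mul1r eu; ring.
  apply: IdlD => //; apply: IdlB => //; apply: IdlB => //; exact: IdlMl.
split=> //; apply: (Idl_gauss (coprime_pi_dpi hnz)) => //.
have -> : pi^`()%:P * u = (u * (delta 'X)^`()%:P - x * (u * (delta 1)^`()%:P)) - u * rho%:P.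
  by rewrite d1 dX !(polyCD, polyCM); ring.
apply: IdlB; last exact: (Idl_h_gam hnz).
by apply: IdlB => //; apply: IdlMl.
Qed.

(** Writing u = gam u2, the term gam' u2 of dx u lies in [gam] A because pi gam' u2 = - u rho lies
    in h A. The divergence then has all its terms in [gam] A. *)
Lemma central_div u1 : u = pi%:P * u1 -> Idl gam (w%:P * u1).
Proof.
move=> eu; have [[u2 eu2] urho] := central_u eu.
have dxu : Idl gam (dx u).
  rewrite eu2 dxM dxC; apply: IdlD; last exact: IdlC.
  apply: Idl_h_pi; rewrite mulrA -polyCM mulrC [pi * _]mulrC dgamE // mulrC.
  have -> : (gam * (w - pi^`()))%:P * u2 = - (u * rho%:P).
    by rewrite eu2 polyCM !polyCB; ring.
  exact: IdlN.
rewrite -[w%:P * u1](subrK (dx u + v^`() - h2%:P * u^`())).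
apply: IdlD; first exact: der_div_gam.
apply: IdlB; last by apply/IdlMl/Idl_deriv; exists u2.
by apply: IdlD => //; apply/Idl_deriv/central_v.
Qed.

Lemma central_coboundary f : cocyA f ->
  exists2 g, linF g & forall P Q, gbr D f P Q = hoch g P Q.
Proof.
move=> cf; have [u1 eu] := der_x_pi hnz derD.
apply: (Phi_gam_coboundary charF0 hnz); first exact: gbr_cocy.
have [gu _] := central_u eu.
have := Phi_gbr hnz derD (a := PhiA f) cf eu; rewrite subrr => /(_ (Idl0 _)) main.
rewrite -[PhiA _](subrK (u * dx (PhiA f) + v * (PhiA f)^`() - PhiA f * (w%:P * u1))).
apply: IdlD => //; apply: IdlB; last exact/IdlMl/central_div.
by apply: IdlD; apply: IdlMr => //; apply: central_v.
Qed.

End Center.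

End CenterAction.

(** * Differential operators on F(x) *)

Section RationalFunctions.
Variable F : fieldType.
Local Notation K := {fraction {poly F}}.
Local Notation der := (@deriv_frac F : K -> K).
Local Notation pF := (@pF F : {poly F} -> K).
Implicit Types (r s : K) (p q : {poly F}).

Lemma pF1 : pF 1 = 1. Proof. exact: rmorph1. Qed.
Lemma pFD : {morph pF : p q / p + q}. Proof. exact: rmorphD. Qed.
Lemma pFB : {morph pF : p q / p - q}. Proof. exact: rmorphB. Qed.
Lemma pFM : {morph pF : p q / p * q}. Proof. exact: rmorphM. Qed.
Lemma pFMn n : {morph pF : p / p *+ n}. Proof. exact: rmorphMn. Qed.

Lemma pF_eq0 p : (pF p == 0) = (p == 0).
Proof. exact: tofrac_eq0. Qed.

Lemma repr_frac r : r * pF (frac (repr r)).2 = pF (frac (repr r)).1.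
Proof.
rewrite /Defs.pF -{1}[r]reprK; unlock FracField.tofrac; rewrite -[LHS]FracField.pi_mul.
apply/eqmodP; rewrite /= FracField.equivfE /FracField.mulf.
by rewrite !numden_Ratio ?oner_eq0 ?mulr1 ?mul1r ?mulf_neq0 ?denom_ratioP ?oner_neq0 // mulrC.
Qed.

Lemma frac_ex r : exists n d, d != 0 /\ r * pF d = pF n.
Proof.
exists (frac (repr r)).1, (frac (repr r)).2; split; first exact: denom_ratioP.
exact: repr_frac.
Qed.

(** The quotient rule may be read off any representative: differentiate the cross-multiplied
    identity p d = n q. *)
Lemma der_frac r p q : q != 0 -> r * pF q = pF p ->
  der r * pF q ^+ 2 = pF (p^`() * q - p * q^`()).
Proof.
move=> nzq erq; rewrite /deriv_frac.
have := repr_frac r; set n := (frac _).1; set d := (frac _).2 => e.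
have nzd : d != 0 by apply: denom_ratioP.
have nzD : pF (d ^+ 2) != 0 by rewrite pF_eq0 expf_neq0.
have epq : p * d = n * q.
  apply/eqP; rewrite -tofrac_eq; apply/eqP; change (pF (p * d) = pF (n * q)).
  by rewrite !pFM -e -erq mulrAC.
have dpq : p^`() * d + p * d^`() = n^`() * q + n * q^`() by rewrite -!derivM epq.
apply: (mulIf nzD); rewrite mulrAC divfK // expr2 -!pFM; congr (pF _).
have -> : (n^`() * d - n * d^`()) * (q * q) =
  d * q * (n^`() * q + n * q^`()) - (n * q) * (d * q^`() + d^`() * q) by ring.
by rewrite -dpq -epq; ring.
Qed.

Lemma der_pF p : der (pF p) = pF p^`().
Proof.
have e : pF p * pF 1 = pF p by rewrite pF1 mulr1.
have := der_frac (oner_neq0 _) e.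
by rewrite pF1 expr1n mulr1 (derivC 1) mulr0 subr0 mulr1.
Qed.

Lemma der_add : {morph der : r s / r + s}.
Proof.
move=> r s; have [n [d [nzd er]]] := frac_ex r; have [m [e [nze es]]] := frac_ex s.
have nzde : d * e != 0 by apply: mulf_neq0.
have ers : (r + s) * pF (d * e) = pF (n * e + m * d).
  by rewrite pFD !pFM -er -es; ring.
have dr := der_frac nzd er; have ds := der_frac nze es.
have nzD : pF (d * e) ^+ 2 != 0 by rewrite expf_neq0 // pF_eq0.
apply: (mulIf nzD); rewrite (der_frac nzde ers) [RHS]mulrDl (pFM d e).
have -> : der r * (pF d * pF e) ^+ 2 = der r * pF d ^+ 2 * pF e ^+ 2 by ring.
have -> : der s * (pF d * pF e) ^+ 2 = der s * pF e ^+ 2 * pF d ^+ 2 by ring.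
rewrite dr ds !expr2 -!pFM -pFD !(derivD, derivM); congr (pF _); ring.
Qed.

Lemma der_mul r s : der (r * s) = der r * s + r * der s.
Proof.
have [n [d [nzd er]]] := frac_ex r; have [m [e [nze es]]] := frac_ex s.
have nzde : d * e != 0 by apply: mulf_neq0.
have ers : r * s * pF (d * e) = pF (n * m) by rewrite !pFM -er -es; ring.
have dr := der_frac nzd er; have ds := der_frac nze es.
have nzD : pF (d * e) ^+ 2 != 0 by rewrite expf_neq0 // pF_eq0.
apply: (mulIf nzD); rewrite (der_frac nzde ers) [RHS]mulrDl (pFM d e).
have -> : der r * s * (pF d * pF e) ^+ 2 = der r * pF d ^+ 2 * (s * pF e) * pF e by ring.
have -> : r * der s * (pF d * pF e) ^+ 2 = der s * pF e ^+ 2 * (r * pF d) * pF d by ring.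
rewrite dr ds er es -!pFM -pFD !derivM; congr (pF _); ring.
Qed.

End RationalFunctions.

(** * Faithful representation of normal forms by operators on F(x) *)

Section Operators.
Variables (F : fieldType) (charF0 : [pchar F] =i pred0).
Variables (h : {poly F}) (hnz : h != 0).
Local Notation PP := {poly {poly F}}.
Local Notation K := {fraction {poly F}}.
Local Notation der := (@deriv_frac F : K -> K).
Local Notation pF := (@pF F : {poly F} -> K).
Local Notation gam := (gcdh h).
Local Notation star := (star h).
Local Notation H := (h%:P : PP).
Local Notation x := ('X%:P : PP).
Local Notation T := (opyhat h : K -> K).
Implicit Types (p q : {poly F}) (P Q R : PP) (u v : K) (A B : op F).

Lemma T_add : {morph T : u v / u + v}.
Proof. by move=> u v; rewrite /opyhat /opcomp /opmul mulrDr; apply: der_add. Qed.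

Lemma T_mul u v : T (u * v) = u * T v + der u * (pF h * v).
Proof.
rewrite /opyhat /opcomp /opmul /opy mulrCA (der_mul u (pF h * v)); exact: addrC.
Qed.

Lemma T_lin p u : T (pF p * u) = pF p * T u + pF (hder h p) * u.
Proof. by rewrite T_mul der_pF; congr (_ + _); rewrite /hder pFM mulrCA -mulrA. Qed.

Definition phi Q : op F := ev (@FracField.tofrac {poly F}) T Q.

Lemma phi_addr Q : {morph (phi Q : K -> K) : u v / u + v}.
Proof. exact: (evDr _ T_add). Qed.
Lemma phi_r0 Q : phi Q 0 = 0.
Proof. by apply: (addrI (phi Q 0)); rewrite -phi_addr !addr0. Qed.
Lemma phi_oppr Q : {morph (phi Q : K -> K) : u / - u}.
Proof. by move=> u; apply: (addrI (phi Q u)); rewrite -phi_addr !subrr phi_r0. Qed.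

Lemma phi_starE P Q u : phi (star P Q) u = phi P (phi Q u).
Proof. by apply: ev_star; [exact: T_add | exact: T_lin]. Qed.
Lemma phiDE P Q u : phi (P + Q) u = phi P u + phi Q u.
Proof. exact: evD. Qed.
Lemma phiCE p u : phi p%:P u = pF p * u.
Proof. exact: evC. Qed.
Lemma phiCME p Q u : phi (p%:P * Q) u = pF p * phi Q u.
Proof. exact: evCM. Qed.
Lemma phiXE u : phi 'X u = T u.
Proof. exact: evX. Qed.
Lemma phi0E u : phi 0 u = 0.
Proof. exact: ev0. Qed.
Lemma phiNE Q u : phi (- Q) u = - phi Q u.
Proof. by apply: (addrI (phi Q u)); rewrite -phiDE !subrr phi0E. Qed.
Lemma phiBE P Q u : phi (P - Q) u = phi P u - phi Q u.
Proof. by rewrite phiDE phiNE. Qed.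
Lemma phi_sumE (I : Type) (r : seq I) (A : pred I) (G : I -> PP) u :
  phi (\sum_(i <- r | A i) G i) u = \sum_(i <- r | A i) phi (G i) u.
Proof. exact: (big_morph (phi^~ u) (fun P Q => phiDE P Q u) (phi0E u)). Qed.

Lemma phi_star P Q : phi (star P Q) = opcomp (phi P) (phi Q).
Proof. by apply: functional_extensionality => u; rewrite phi_starE. Qed.
Lemma phiD P Q : phi (P + Q) = opadd (phi P) (phi Q).
Proof. by apply: functional_extensionality => u; rewrite phiDE. Qed.
Lemma phiB P Q : phi (P - Q) = opsub (phi P) (phi Q).
Proof. by apply: functional_extensionality => u; rewrite phiBE. Qed.
Lemma phiC p : phi p%:P = opmul (pF p).
Proof. by apply: functional_extensionality => u; rewrite phiCE. Qed.
Lemma phiZ (a : F) Q : phi (a%:P%:P * Q) = opscale a (phi Q).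
Proof. by apply: functional_extensionality => u; rewrite phiCME. Qed.
Lemma phiX : phi 'X = opyhat h.
Proof. by apply: functional_extensionality => u; rewrite phiXE. Qed.
Lemma phi0 : phi 0 = @opzero F.
Proof. by apply: functional_extensionality => u; rewrite phi0E. Qed.
Lemma phi1 : phi 1 = @opone F.
Proof.
by apply: functional_extensionality => u; rewrite -[1]/(1%:P) phiCE pF1 mul1r.
Qed.
Lemma phi_x : phi x = @opx F.
Proof. exact: phiC. Qed.
Lemma phi_lie P Q : phi (star P Q - star Q P) = lie (phi P) (phi Q).
Proof. by rewrite phiB !phi_star. Qed.

Lemma phi_Xn n : phi 'X^n = oppow (opyhat h) n.
Proof.
elim: n => [|n IHn]; first by rewrite expr0 phi1.
by rewrite exprS -(star_mulX h) phi_star phiX IHn.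
Qed.
Lemma phi_xn n : phi ('X^n)%:P = oppow (@opx F) n.
Proof.
elim: n => [|n IHn]; first by rewrite expr0 phi1.
by rewrite exprS polyCM -(starC h) phi_star phi_x IHn.
Qed.

(** If Q acts as zero, so does its commutator with x, hence also [kap h Q], which has lower degree.
    By induction [kap h Q] = 0, so in characteristic 0 Q has degree 0 in yhat, and applying it to 1
    gives Q = 0. *)
Lemma phi_eq0 Q : phi Q = @opzero F -> Q = 0.
Proof.
elim: (size Q) {-2}Q (leqnn (size Q)) => {Q} [|n IHn] Q sQ phiQ.
  by apply/eqP; rewrite -size_poly_leq0.
have kQ : kap h Q = 0.
  apply: IHn; first exact: size_kap.
  apply: functional_extensionality => u.
  have nzh : pF h != 0 by rewrite pF_eq0.
  apply: (mulfI nzh); rewrite -phiCME.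
  have -> : H * kap h Q = star Q x - x * Q by rewrite star_x addrC addKr.
  by rewrite phiBE phi_starE phiCME !phiQ /opzero !mulr0 subrr.
have sQ1 : (size Q <= 1)%N.
  rewrite leqNgt; apply/negP; case sQm: (size Q) => [|[|m]] // _.
  have [c cm] := natr_unit_poly charF0 m.
  have : Q`_m.+1 != 0 by have := lead_coef_eq0 Q; rewrite lead_coefE sQm -size_poly_eq0 sQm => ->.
  by rewrite -[Q`_m.+1]mul1r -cm -mulrA -(kap_coef h) ?sQm // kQ coef0 mulr0 eqxx.
have := congr1 (fun A : op F => A 1) phiQ; rewrite (size1_polyC sQ1) phiCE mulr1 /opzero.
by move/eqP; rewrite pF_eq0 => /eqP ->; rewrite polyC0.
Qed.

Lemma phi_inj : injective phi.
Proof.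
move=> P Q e; apply/eqP; rewrite -subr_eq0; apply/eqP/phi_eq0.
by rewrite phiB e; apply: functional_extensionality => u; apply: subrr.
Qed.

Lemma inA_polyC p : inA h (opmul (pF p)).
Proof.
elim/poly_ind: p => [|p c IHp].
  by have := inA_scal h 0; rewrite polyC0.
rewrite -phiC polyCD phiD polyCM -(starC h) phi_star phi_x !phiC.
by apply: inA_add; [apply: inA_comp => //; apply: inA_x | apply: inA_scal].
Qed.

Lemma inA_phi Q : inA h (phi Q).
Proof.
elim/poly_ind: Q => [|Q p IHQ]; first by rewrite -polyC0 phiC; apply: inA_polyC.
rewrite phiD phiC; apply: inA_add; last exact: inA_polyC.
by rewrite -(star_rX h) phi_star phiX; apply: inA_comp => //; apply: inA_yhat.
Qed.

Lemma inA_ex A : inA h A -> exists Q, phi Q = A.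
Proof.
elim=> {A} [c| | |A B _ [P <-] _ [Q <-]|A B _ [P <-] _ [Q <-]].
- by exists c%:P%:P; apply: phiC.
- by exists x; apply: phi_x.
- by exists 'X; apply: phiX.
- by exists (P + Q); apply: phiD.
- by exists (star P Q); apply: phi_star.
Qed.

(** The normal form of an operator in A; outside A the value is arbitrary. *)
Definition psi A : PP := epsilon (inhabits 0) (fun Q => phi Q = A).

Lemma psiK A : inA h A -> phi (psi A) = A.
Proof. by move/inA_ex; apply: (epsilon_spec (inhabits 0)). Qed.
Lemma phiK Q : psi (phi Q) = Q.
Proof. exact/phi_inj/psiK/inA_phi. Qed.

Lemma congA_phi P Q : congA h (phi P) (phi Q) <-> Idl gam (P - Q).
Proof.
have e R : phi (Q + gam%:P * R) = opadd (phi Q) (opcomp (opmul (pF gam)) (phi R)).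
  by rewrite -phiC -phi_star -phiD starC.
split=> [[b [/inA_ex [B <-]]]|[B eB]].
  by rewrite -e => /phi_inj ->; exists B; rewrite addrC addKr.
by exists (phi B); split; [apply: inA_phi | rewrite -e -eB addrC subrK].
Qed.

End Operators.

(** * ad (g a_n) as an operator, and transport of cochains to normal forms *)

Section InnerLocal.
Variables (F : fieldType) (charF0 : [pchar F] =i pred0).
Variables (h : {poly F}) (hnz : h != 0).
Local Notation PP := {poly {poly F}}.
Local Notation K := {fraction {poly F}}.
Local Notation der := (@deriv_frac F : K -> K).
Local Notation pF := (@pF F : {poly F} -> K).
Local Notation gam := (gcdh h).
Local Notation pi := (pih h).
Local Notation w := (wh h).
Local Notation L := (lmulY h).
Local Notation star := (star h).
Local Notation H := (h%:P : PP).
Local Notation x := ('X%:P : PP).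
Local Notation T := (opyhat h : K -> K).
Local Notation phi := (phi h).
Local Notation psi := (psi h).
Local Notation delta := (deltap h).
Local Notation hy := (hy h).
Implicit Types (p q : {poly F}) (P Q R : PP) (u v : K) (A B : op F).

Lemma hy_X m : star (hy m) 'X = hy m * 'X.
Proof. exact: star_rX. Qed.

(** This is [y^m, x] = m y^(m-1) multiplied by h^m. *)
Lemma hy_x m : star (hy m) x - x * hy m = m%:R * (H * hy m.-1).
Proof.
elim: m => [|m IHm]; first by rewrite star1l mulr1 mul0r subrr.
have em : star (hy m) x = x * hy m + m%:R * (H * hy m.-1) by rewrite -IHm addrC subrK.
have -> : star (hy m.+1) x = L (star (hy m) x) - m.+1%:R * h^`()%:P * star (hy m) x.
  rewrite /= starBl starLr.
  have -> : m.+1%:R * h^`()%:P * hy m = (m.+1%:R * h^`())%:P * hy m :> PP.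
    by rewrite polyCM rmorph_nat.
  by rewrite starCM polyCM rmorph_nat.
have Lx : L (x * hy m) = x * L (hy m) + H * hy m.
  by rewrite LCM /hder derivX mulr1.
have LH : m%:R * L (H * hy m.-1) = H * (m%:R * hy m + m%:R * m.+1%:R * (h^`()%:P * hy m.-1)).
  case: m {IHm em Lx} => [|m]; first by rewrite !mul0r addr0 mulr0.
  by rewrite LCM /hder polyCM /= -[m.+2%:R]natr1; ring.
have Lm : L (m%:R * (H * hy m.-1)) = m%:R * L (H * hy m.-1).
  have -> : m%:R = (m%:R : {poly F})%:P :> PP by rewrite rmorph_nat.
  by rewrite LCM /hder -polyC_natr derivC mulr0 polyC0 mul0r addr0.
rewrite em LD Lx Lm LH /= -[m.+1%:R]natr1; ring.
Qed.

(** Since yhat h^m y^m = y h^(m+1) y^m, the product rule produces an extra term (m+1) h' h^m y^m,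
    which the recursion of [hy] subtracts. *)
Lemma hy_pow m u : phi (hy m) u = pF (h ^+ m) * oppow (@opy F) m u.
Proof.
elim: m => [|m IHm]; first by rewrite (phi1 h) expr0 pF1 mul1r.
have -> : hy m.+1 = L (hy m) - (m.+1%:R * h^`())%:P * hy m.
  by rewrite /= polyCM rmorph_nat.
rewrite phiBE phiCME -starX phi_starE phiXE IHm.
have -> : T (pF (h ^+ m) * oppow (@opy F) m u) =
    der (pF (h ^+ m.+1) * oppow (@opy F) m u).
  by rewrite /opyhat /opcomp /opmul /opy exprS pFM mulrA.
rewrite der_mul der_pF deriv_exp /=.
have -> : h^`() * h ^+ m *+ m.+1 = m.+1%:R * h^`() * h ^+ m.
  by rewrite -mulr_natl mulrA.
by rewrite [pF (_ * _ * _)]pFM -mulrA addrAC subrr add0r.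
Qed.

(* Uniform in n, including a_0 = pi_h / h. *)
Lemma ga_phi g n : ga h g n = opcomp (opmul (pF (g * pi) / pF h)) (phi (hy n)).
Proof.
apply: functional_extensionality => u; rewrite /opcomp /opmul hy_pow.
case: n => [|n].
  by rewrite /ga /opmul expr0 pF1 mul1r pFM.
rewrite /ga /opcomp /opmul !pFM exprS pFM; set X := oppow _ _ _.
have nzh : pF h != 0 by rewrite pF_eq0.
by rewrite !mulrA divfK.
Qed.

Lemma pi_dh : pi * h^`() = w * h.
Proof.
transitivity (w * (lcc h * pi * gam)); last by rewrite -(hE hnz).
by rewrite (dhE hnz); ring.
Qed.

Lemma delta_der g : pF h * der (pF (g * pi) / pF h) = pF (delta g).
Proof.
have nzh : pF h != 0 by rewrite pF_eq0.
have e : pF (g * pi) / pF h * pF h = pF (g * pi) by rewrite divfK.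
have := der_frac hnz e; set r := der _ => er.
have rE : pF h * r * pF h = r * pF h ^+ 2 by ring.
apply: (mulIf nzh); rewrite rE er -pFM; congr (pF _).
by rewrite /deltap mulrBl -!mulrA pi_dh; ring.
Qed.

Lemma delta0E g : delta0 h g = pF (delta g).
Proof.
have nzh : pF h != 0 by rewrite pF_eq0.
rewrite /delta0 pFB; congr (_ - _); apply: (mulIf nzh).
by rewrite divfK // -!pFM -!mulrA pi_dh.
Qed.

Lemma pi_dh_div : pF pi * pF h^`() / pF h = pF w.
Proof.
have nzh : pF h != 0 by rewrite pF_eq0.
by rewrite -pFM pi_dh pFM mulfK.
Qed.

Section AdGa.
Variables (g : {poly F}) (n : nat).
Local Notation ga := (ga h g n).
Local Notation adx := (n%:R * ((g * pi)%:P * hy n.-1)).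
Local Notation ady := (- ((delta g)%:P * hy n + (g * pi)%:P * dx (hy n))).

Let c : K := pF (g * pi) / pF h.

Lemma lie_gaE A u : lie ga A u = c * phi (hy n) (A u) - A (c * phi (hy n) u).
Proof. by rewrite ga_phi. Qed.

Let ch : c * pF h = pF (g * pi).
Proof. by rewrite /c divfK // pF_eq0. Qed.

Lemma lie_ga_x : lie ga (phi x) = phi adx.
Proof.
apply: functional_extensionality => u; rewrite lie_gaE -phi_starE phiCE.
rewrite mulrCA -mulrBr -phiCME -phiBE hy_x.
have -> m Q : m%:R * (H * Q) = (m%:R * h)%:P * Q.
  by rewrite polyCM rmorph_nat mulrA.
have -> : n%:R * ((g * pi)%:P * hy n.-1) = (n%:R * (g * pi))%:P * hy n.-1.
  by rewrite [in RHS]polyCM rmorph_nat mulrA.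
have cn : c * pF (n%:R * h) = pF (n%:R * (g * pi)) by rewrite pFM mulrCA ch -pFM.
by rewrite !phiCME -cn -mulrA.
Qed.

(** Moving yhat past the coefficient g pi / h yields h (g pi / h)' = delta(g); moving it past [hy n]
    yields h dx (hy n), whose factor h cancels the denominator. *)
Lemma lie_ga_y : lie ga (phi 'X) = phi ady.
Proof.
apply: functional_extensionality => u; rewrite lie_gaE -phi_starE hy_X phiXE T_mul.
rewrite -phiXE -phi_starE starX.
have -> : L (hy n) = hy n * 'X + H * dx (hy n) by [].
rewrite phiNE phiDE [phi (_ + _) u]phiDE !phiCME mulrDr mulrA ch.
rewrite [der _ * _]mulrA [der _ * _]mulrC delta_der.
ring.
Qed.

Lemma lie_ga_comp P Q : lie ga (phi (star P Q)) =
  opadd (opcomp (lie ga (phi P)) (phi Q)) (opcomp (phi P) (lie ga (phi Q))).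
Proof.
apply: functional_extensionality => u; rewrite /opadd /opcomp !lie_gaE !phi_starE.
by rewrite phi_addr phi_oppr addrA subrK.
Qed.

Lemma lie_ga_add P Q : lie ga (phi (P + Q)) = opadd (lie ga (phi P)) (lie ga (phi Q)).
Proof.
apply: functional_extensionality => u; rewrite /opadd !lie_gaE !phiDE phi_addr.
by rewrite mulrDr opprD addrACA.
Qed.

Lemma lie_ga_scal (a : F) : lie ga (phi a%:P%:P) = phi 0.
Proof.
apply: functional_extensionality => u; rewrite lie_gaE -phi_starE -[a%:P%:P]mulr1.
by rewrite star_cr starr1 !phiCME phi1 /opone mulrCA phi0E subrr.
Qed.

(** The operator g a_n has a denominator h and need not lie in A. Its commutators with x and yhat
    do, and the Leibniz rule extends this to all of A. *)
Lemma lie_ga_phi Q : exists R, lie ga (phi Q) = phi R.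
Proof.
pose S Q := exists R, lie ga (phi Q) = phi R.
have SM P R : S P -> S R -> S (star P R).
  move=> [P' eP] [R' eR]; exists (star P' R + star P R').
  by rewrite lie_ga_comp eP eR phiD !phi_star.
have Sc (a : F) : S a%:P%:P by exists 0; apply: lie_ga_scal.
have S1 : S 1 := Sc 1.
elim/PP_ind: Q => [P R [P' eP] [R' eR]|a i j].
  by exists (P' + R'); rewrite lie_ga_add eP eR phiD.
rewrite -(starC h) -(starC h ('X^i)); apply: (SM) => //; apply: (SM).
  elim: i => [|i IHi]; rewrite ?expr0 // exprS polyCM -(starC h).
  by apply: SM => //; exists adx; apply: lie_ga_x.
elim: j => [|j IHj]; rewrite ?expr0 // exprS -(star_mulX h).
by apply: SM => //; exists ady; apply: lie_ga_y.
Qed.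

Lemma ad_ga_der : is_der h (ad_ga h g n).
Proof.
have scalE (a : F) Q : opscale a (phi Q) = phi (star a%:P%:P Q) by rewrite starC phiZ.
have lie_scal (a : F) Q : lie ga (phi (star a%:P%:P Q)) = opscale a (lie ga (phi Q)).
  rewrite lie_ga_comp lie_ga_scal; have [R ->] := lie_ga_phi Q.
  by rewrite -!phi_star star0l -phiD add0r -scalE.
split; first split.
- by move=> _ /inA_ex [Q <-]; have [R eR] := lie_ga_phi Q; rewrite /ad_ga eR; apply: inA_phi.
- split=> [_ _ /inA_ex [P <-] /inA_ex [Q <-]|a _ /inA_ex [Q <-]].
    by rewrite /ad_ga -phiD lie_ga_add.
  by rewrite /ad_ga scalE lie_scal.
- by move=> _ _ /inA_ex [P <-] /inA_ex [Q <-]; rewrite /ad_ga -phi_star lie_ga_comp.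
Qed.

End AdGa.

Definition pull1 (D : op F -> op F) Q : PP := psi (D (phi Q)).
Definition pull2 (f : op F -> op F -> op F) P Q : PP := psi (f (phi P) (phi Q)).

Lemma pull1E D Q : cochain1 h D -> phi (pull1 D Q) = D (phi Q).
Proof. by case=> DA _; rewrite psiK //; apply/DA/inA_phi. Qed.

Lemma pull2E f P Q : cochain2 h f -> phi (pull2 f P Q) = f (phi P) (phi Q).
Proof. by case=> fA _; rewrite psiK //; apply: fA; apply: inA_phi. Qed.

Lemma pull1_lin D : cochain1 h D -> linF (pull1 D).
Proof.
move=> cD; have [DA [Dadd Dscal]] := cD; split=> [P Q|a Q]; apply: (phi_inj charF0 hnz).
  by rewrite phiD !pull1E // phiD Dadd //; apply: inA_phi.
by rewrite phiZ !pull1E // phiZ Dscal //; apply: inA_phi.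
Qed.

Lemma pull1_der D : is_der h D -> derA h (pull1 D).
Proof.
move=> [cD Dmul]; split; first exact: pull1_lin.
move=> P Q; apply: (phi_inj charF0 hnz).
by rewrite phiD !phi_star !pull1E // phi_star Dmul //; apply: inA_phi.
Qed.

Lemma pull2_cocy f : cocycle2 h f -> cocyA h (pull2 f).
Proof.
move=> [cf cocf]; have [fA [fl [fr fs]]] := cf; split.
  split=> Q; split=> [P P'|a P]; apply: (phi_inj charF0 hnz).
  - by rewrite phiD !pull2E // phiD fl //; apply: inA_phi.
  - by rewrite phiZ !pull2E // phiZ (fs _ _ _ _ _).1 //; apply: inA_phi.
  - by rewrite phiD !pull2E // phiD fr //; apply: inA_phi.
  - by rewrite phiZ !pull2E // phiZ (fs _ _ _ _ _).2 //; apply: inA_phi.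
move=> P Q R; apply: (phi_inj charF0 hnz).
rewrite phi0 phiD !phiB !phi_star !pull2E // !phi_star.
by apply: cocf; apply: inA_phi.
Qed.

Lemma Phi_phi (f : op F -> op F -> op F) (f' : PP -> PP -> PP) :
  (forall P Q, f (phi P) (phi Q) = phi (f' P Q)) -> Phi h f = phi (PhiW h f').
Proof.
move=> ff'; apply: functional_extensionality => u.
rewrite /Phi /PhiW /opadd /opsub phiDE !phiBE phiCME -!ff' phiX phi_x (phi1 h).
congr (_ - _ + _); rewrite phi_sumE; apply: eq_bigr => k _.
rewrite phi_sumE; apply: eq_bigr => i _.
by rewrite phiCME phi_starE -ff' !phi_xn phi_x.
Qed.

Lemma gbracket_phi D f P Q : is_der h D -> cocycle2 h f ->
  gbracket D f (phi P) (phi Q) = phi (gbr (pull1 D) (pull2 f) P Q).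
Proof.
move=> [cD _] [cf _]; rewrite /gbracket /gbr phiB phiD.
by rewrite pull1E // !pull2E // !pull1E.
Qed.

Lemma pull1_ad_spec g n : ad_spec h g n (pull1 (ad_ga h g n)).
Proof.
have dE := ad_ga_der g n.
split; first exact: pull1_der.
  apply: (phi_inj charF0 hnz); rewrite pull1E; last exact: dE.1.
  exact: lie_ga_x.
apply: (phi_inj charF0 hnz); rewrite pull1E; last exact: dE.1.
exact: lie_ga_y.
Qed.

End InnerLocal.

(** * Transfer of the two statements to operators *)

Section Main.
Variables (F : fieldType) (charF0 : [pchar F] =i pred0).
Variables (h : {poly F}) (hnz : h != 0).
Local Notation PP := {poly {poly F}}.
Local Notation K := {fraction {poly F}}.
Local Notation gam := (gcdh h).
Local Notation pi := (pih h).
Local Notation w := (wh h).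
Local Notation star := (star h).
Local Notation H := (h%:P : PP).
Local Notation x := ('X%:P : PP).
Local Notation phi := (phi h).
Local Notation psi := (psi h).
Local Notation delta := (deltap h).
Local Notation hy := (hy h).
Implicit Types (p q : {poly F}) (P Q R : PP) (u v : K) (A B : op F).

Lemma center_trivial D : is_der h D ->
  (forall E, is_der h E -> is_inner h (der_bracket D E)) ->
  forall f, cocycle2 h f -> coboundary2 h (gbracket D f).
Proof.
move=> dD central f cf; have [cD _] := dD.
have central' p n : exists2 E, ad_spec h p n E & exists c, forall Q,
    pull1 h D (E Q) - E (pull1 h D Q) = star c Q - star Q c.
  have dE := ad_ga_der hnz p n; exists (pull1 h (ad_ga h p n)).
    exact: pull1_ad_spec.
  have [_ [/inA_ex [c <-] inn]] := central _ dE; exists c => Q.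
  apply: (phi_inj charF0 hnz); rewrite phi_lie -inn; last exact: inA_phi.
  by rewrite phiB !pull1E //; case: dE.
have [g lg eg] := central_coboundary charF0 hnz (pull1_der charF0 hnz dD) central'
  (pull2_cocy charF0 hnz cf).
exists (fun A => phi (g (psi A))); split.
  split=> [A _|]; first exact: inA_phi.
  split=> [_ _ /inA_ex [P <-] /inA_ex [Q <-]|a _ /inA_ex [Q <-]].
    by rewrite -phiD !(phiK charF0 hnz) (linD lg) phiD.
  by rewrite -phiZ !(phiK charF0 hnz) (linZ lg) phiZ.
move=> _ _ /inA_ex [P <-] /inA_ex [Q <-].
rewrite gbracket_phi // eg /hochA /hoch1 -(phi_star h P Q) !(phiK charF0 hnz).
by rewrite phiD phiB !phi_star.
Qed.

Lemma hy_mod n : Idl gam (hy n - 'X^n).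
Proof.
elim: n => [|n IHn]; first by rewrite subrr; apply: Idl0.
have -> : hy n.+1 - 'X^(n.+1) =
    (hy n - 'X^n) * 'X + H * dx (hy n) - h^`()%:P * (n.+1%:R * hy n).
  by rewrite /= /lmulY exprSr; ring.
apply: IdlB; last exact: Idl_dhC.
by apply: IdlD; [apply: IdlMr | apply: Idl_hC].
Qed.

(** Modulo [gam], [hy n] is yhat^n, which dx kills, and pi d/dx preserves multiples of [gam]. *)
Lemma pi_dx_hy n : Idl gam (pi%:P * dx (hy n)).
Proof.
have [B eB] := hy_mod n.
have -> : hy n = 'X^n + gam%:P * B by rewrite -eB addrC subrK.
rewrite dxD dxXn add0r dxM dxC.
have -> : pi%:P * (gam^`()%:P * B + gam%:P * dx B) =
  (gam^`() * pi)%:P * B + gam%:P * (pi%:P * dx B) by rewrite polyCM; ring.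
by rewrite dgamE // polyCM -mulrA; apply: IdlD; apply: IdlC.
Qed.

Lemma Phi_gbr_ad g p n k E f : ad_spec h g n E -> cocyA h f ->
  Idl gam (PhiW h f - p%:P * 'X^k) ->
  Idl gam (PhiW h (gbr E f) -
    (pi * g * p^`() *+ n - g * w * p *+ n - delta g * p *+ k)%:P * 'X^(n + k - 1)).
Proof.
move=> [dE ex ey] cf fa.
have eu : E x = pi%:P * (n%:R * (g%:P * hy n.-1)) by rewrite ex polyCM; ring.
have main := Phi_gbr hnz dE cf eu fa; rewrite -[PhiW h _](subrK
  (E x * dx (p%:P * 'X^k) + E 'X * (p%:P * 'X^k)^`() - 
   p%:P * 'X^k * (w%:P * (n%:R * (g%:P * hy n.-1))))).
rewrite -addrA; apply: IdlD => //.
(* The factors n and k absorb the truncated subtractions, including n = k = 0, where both sides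
   vanish. *)
have en : n%:R * 'X^(n.-1) * 'X^k = n%:R * 'X^(n + k - 1) :> PP.
  by case: (n) => [|m]; rewrite ?mul0r // -mulrA -exprD addSn subn1.
have ek : k%:R * 'X^n * 'X^(k.-1) = k%:R * 'X^(n + k - 1) :> PP.
  by case: (k) => [|m]; rewrite ?mul0r // -mulrA -exprD addnS subn1.
rewrite dxM dxC dxXn mulr0 addr0 derivM derivC mul0r add0r derivXn -mulr_natr ex ey.
have -> : (pi * g * p^`() *+ n - g * w * p *+ n - delta g * p *+ k)%:P * 'X^(n + k - 1) =
   (pi * g * p^`() - g * w * p)%:P * (n%:R * 'X^(n + k - 1))
   - (delta g * p)%:P * (k%:R * 'X^(n + k - 1)) :> PP.
  have polyCMn q m : (q *+ m)%:P = q%:P * m%:R :> PP by rewrite rmorphMn mulr_natr.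
  rewrite -mulrnBl; move: (pi * g * p^`()) (g * w * p) (delta g * p) 'X^_ => a b d Y.
  by rewrite polyCB !polyCMn; ring.
rewrite -en -ek.
set Y := 'X^(n.-1); set Z := 'X^(k.-1); set Yn := 'X^n; set Yk := 'X^k.
have -> : n%:R * ((g * pi)%:P * hy n.-1) * (p^`()%:P * Yk) +
    - ((delta g)%:P * hy n + (g * pi)%:P * dx (hy n)) * (p%:P * (Z * k%:R)) -
    p%:P * Yk * (w%:P * (n%:R * (g%:P * hy n.-1))) -
    ((pi * g * p^`() - g * w * p)%:P * (n%:R * Y * Yk) -
     (delta g * p)%:P * (k%:R * Yn * Z)) =
  (hy n.-1 - Y) * (n%:R * Yk * (pi * g * p^`() - g * w * p)%:P)
  - (hy n - Yn) * (k%:R * Z * (delta g * p)%:P)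
  - (pi%:P * dx (hy n)) * (g%:P * p%:P * Z * k%:R).
  by rewrite !(polyCB, polyCM); ring.
by apply: IdlB; [apply: IdlB|]; apply: IdlMr; [exact: hy_mod | exact: hy_mod | exact: pi_dx_hy].
Qed.

End Main.

Theorem theorem6p3 (F : fieldType) (charF0 : [pchar F] =i pred0)
    (h : {poly F}) (hnz : h != 0) :
  (* the center of the Lie algebra HH^1(A) acts trivially on HH^2(A) *)
  (forall D : op F -> op F, is_der h D ->
     (forall E : op F -> op F, is_der h E -> is_inner h (der_bracket D E)) ->
     forall f, cocycle2 h f -> coboundary2 h (gbracket D f)) /\
  (* the formula for [ad_{g a_n}, p yhat^k] in D[yhat] = A / gcd(h,h') A *)
  (forall (g p : {poly F}) (n k : nat) (f : op F -> op F -> op F),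
     cocycle2 h f ->
     congA h (Phi h f) (opcomp (opmul (pF p)) (oppow (opyhat h) k)) ->
     congA h (Phi h (gbracket (ad_ga h g n) f))
       (opcomp (opmul (pF (pih h * g * p^`()) *+ n
                       - pF g * (pF (pih h) * pF h^`() / pF h) * pF p *+ n
                       - delta0 h g * pF p *+ k))
               (oppow (opyhat h) (n + k - 1)))).
Proof.
split; first exact: center_trivial.
move=> g p n k f cf; have [cf2 _] := cf.
have phi_p q m : opcomp (opmul (pF q)) (oppow (opyhat h) m) = phi h (q%:P * 'X^m).
  by rewrite -(phiC h) -phi_Xn -phi_star starC.
rewrite (Phi_phi (f' := pull2 h f)) => [|P Q]; last by rewrite pull2E.
rewrite phi_p => /(congA_phi charF0 hnz) fa.
have dE := ad_ga_der hnz g n.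
rewrite (Phi_phi (fun P Q => gbracket_phi P Q dE cf)).
rewrite (pi_dh_div hnz) (delta0E hnz).
have -> : pF (pih h * g * p^`()) *+ n - pF g * pF (wh h) * pF p *+ n
    - pF (deltap h g) * pF p *+ k =
  pF (pih h * g * p^`() *+ n - g * wh h * p *+ n - deltap h g * p *+ k).
  by rewrite !(pFB, pFMn, pFM).
rewrite phi_p; apply/(congA_phi charF0 hnz)/Phi_gbr_ad => //.
  exact: pull1_ad_spec.
exact: pull2_cocy.
Qed.
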